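(* The following are equivalent: (1) There exists a (not necessarily continuous) linear map $E':c_{00}(\Sigma)\to C(X)'_1$ which is the identity on $C(X)'_{00}$ and is a morphism of left $C(X)$-modules. (2) There exists a (not necessarily continuous) linear map $E':c_{00}(\Sigma)\to C(X)'_1$ which is the identity on $C(X)'_{00}$ and is a morphism of right $C(X)$-modules. (3) The sets $\mathrm{Fix}_k(\sigma)^\circ$ are closed in $X$ for all $k\in\mathbb{Z}$. (4) There exists a faithful involutive norm one projection $E':\ell^1(\Sigma)\to C(X)'_1$ onto $C(X)'_1$, which is a morphism of $C(X)'_1$-bimodules, which restricts to a projection from $c_{00}(\Sigma)$ onto $C(X)'_{00}$, and which is positive in the sense that $\phi(E'(\ell))\ge0$ for all $\ell\in\ell^1(\Sigma)_+$ and all states $\phi$ of $C(X)'_1$.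
   Context: Let $X$ be a non-empty compact Hausdorff space and $\sigma:X\to X$ a homeomorphism; $\mathrm{Fix}_k(\sigma)=\{x:\sigma^kx=x\}$ and superscript $\circ$ denotes interior. $C(X)$ is the algebra of continuous complex functions with sup norm, $\alpha(f)=f\circ\sigma^{-1}$. $\ell^1(\Sigma)$ is the set of $\ell:\mathbb{Z}\to C(X)$ with $\|\ell\|=\sum_k\|\ell(k)\|_\infty<\infty$, product $(\ell\ell')(n)=\sum_k\ell(k)\alpha^k(\ell'(n-k))$, involution $\ell^*(n)=\overline{\alpha^n(\ell(-n))}$; it is a unital Banach $*$-algebra. With $\delta$ the element equal to the constant $1$ at $1\in\mathbb{Z}$ and $0$ elsewhere, elements are written $\sum_kf_k\delta^k$ ($f_k=\ell(k)$), and $C(X)$ is embedded as $\{f\delta^0\}$. $c_{00}(\Sigma)$ is the $*$-subalgebra of finite sums. $C(X)'_1$ and $C(X)'_{00}$ are the commutants of $C(X)$ in $\ell^1(\Sigma)$ and in $c_{00}(\Sigma)$. The positive cone $\ell^1(\Sigma)_+$ is the set of all finite sums $\sum_j\ell_j^*\ell_j$ with $\ell_j\in\ell^1(\Sigma)$; a linear map on $\ell^1(\Sigma)$ is faithful if $0$ is the only element of $\ell^1(\Sigma)_+$ in its kernel. A state of the unital Banach $*$-algebra $C(X)'_1$ is a positive linear functional $\phi$ ($\phi(a^*a)\ge0$) with $\phi(1)=1$. A projection onto $C(X)'_1$ is a linear idempotent map with range $C(X)'_1$; involutive means $E'(\ell^* )=E'(\ell)^*$. *)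

(* Defs.v *)
From HB Require Import structures.
From mathcomp Require Import all_boot all_order all_algebra.
From mathcomp Require Import all_classical all_reals all_analysis.
From mathcomp Require Import complex.
Import Order.TTheory GRing.Theory Num.Theory.

Set Implicit Arguments.
Unset Strict Implicit.
Unset Printing Implicit Defensive.

Local Open Scope ring_scope.
Local Open Scope classical_set_scope.

(* The complex numbers R[i] (R a real type) with their norm topology. *)
HB.instance Definition _ (R : realType) :=
  PseudoPointedMetric.copy R[i] (R[i] : numClosedFieldType)^o.

Section Crossed.
Variables (R : realType) (X : topologicalType) (s si : X -> X).
(* s = sigma, si = sigma^{-1} (hypotheses making them inverse homeomorphisms
   are stated in the theorem). *)

Local Notation C := (R[i]).
(* elements of l^1(Sigma) / c_00(Sigma) are represented as maps int -> C(X),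
   i.e. int -> X -> C, together with membership predicates below. *)
Local Notation Sq := (int -> X -> C).

Definition sigp (k : int) (x : X) : X :=
  match k with
  | Posz n => iter n s x
  | Negz n => iter n.+1 si x
  end.

Definition alphak (k : int) (f : X -> C) : X -> C := fun x => f (sigp (- k) x).

Definition Fixk (k : int) : set X := [set x | sigp k x = x].

Definition supn (f : X -> C) : R :=
  sup [set ComplexField.Normc.normc (f x) | x in [set: X]].

Definition l1norm (l : Sq) : \bar R := (\esum_(k in [set: int]) (supn (l k))%:E)%E.

Definition is_l1 (l : Sq) : Prop :=
  (forall k, continuous (l k)) /\ (l1norm l < +oo)%E.

Definition is_c00 (l : Sq) : Prop :=
  (forall k, continuous (l k)) /\ finite_set [set k | l k <> (fun _ => 0)].

(* sum over Z of a (absolutely summable) family, via symmetric partial sums *)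
Definition zsum (u : int -> C) : C :=
  limn (fun N : nat => \sum_(i < (N + N).+1) u (i%:Z - N%:Z)).

Definition lzero : Sq := fun _ _ => 0.
Definition ladd (l m : Sq) : Sq := fun n x => l n x + m n x.
Definition lscale (a : C) (l : Sq) : Sq := fun n x => a * l n x.

Definition lmul (l l' : Sq) : Sq :=
  fun n x => zsum (fun k => l k x * alphak k (l' (n - k)) x).

Definition lstar (l : Sq) : Sq := fun n x => conjc (alphak n (l (- n)) x).

(* embedding of C(X) as f delta^0, and the unit *)
Definition cst0 (f : X -> C) : Sq := fun n => if n == 0 then f else (fun _ => 0).
Definition lone : Sq := cst0 (fun _ => 1).

Definition comm1 : set Sq :=
  [set l | is_l1 l /\ forall f : X -> C, continuous f -> lmul (cst0 f) l = lmul l (cst0 f)].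
Definition comm00 : set Sq := [set l | is_c00 l] `&` comm1.

Definition l1pos (l : Sq) : Prop :=
  exists (n : nat) (ls : 'I_n -> Sq), (forall j, is_l1 (ls j)) /\
    l = \big[ladd/lzero]_(j < n) lmul (lstar (ls j)) (ls j).

Definition linear_on (D : set Sq) (E : Sq -> Sq) : Prop :=
  forall (a b : C) (l m : Sq), D l -> D m ->
    E (ladd (lscale a l) (lscale b m)) = ladd (lscale a (E l)) (lscale b (E m)).

Definition is_state (phi : Sq -> C) : Prop :=
  [/\ (forall (a b : C) (l m : Sq), comm1 l -> comm1 m ->
         phi (ladd (lscale a l) (lscale b m)) = a * phi l + b * phi m),
      (forall a, comm1 a -> 0 <= phi (lmul (lstar a) a)) &
      phi lone = 1].

Definition norm_one (E : Sq -> Sq) : Prop :=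
  ereal_sup [set l1norm (E l) | l in [set l | is_l1 l /\ (l1norm l <= 1)%E]] = 1%E.

Definition cond1 : Prop :=
  exists E : Sq -> Sq,
    [/\ linear_on is_c00 E,
        (forall l, is_c00 l -> comm1 (E l)),
        (forall l, comm00 l -> E l = l) &
        (forall (f : X -> C) l, continuous f -> is_c00 l ->
           E (lmul (cst0 f) l) = lmul (cst0 f) (E l))].

Definition cond2 : Prop :=
  exists E : Sq -> Sq,
    [/\ linear_on is_c00 E,
        (forall l, is_c00 l -> comm1 (E l)),
        (forall l, comm00 l -> E l = l) &
        (forall (f : X -> C) l, continuous f -> is_c00 l ->
           E (lmul l (cst0 f)) = lmul (E l) (cst0 f))].

Definition cond3 : Prop := forall k : int, closed (interior (Fixk k)).

Definition cond4 : Prop :=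
  exists E : Sq -> Sq,
    linear_on is_l1 E /\
    E @` is_l1 = comm1 /\
    (forall l, is_l1 l -> E (E l) = E l) /\
    (forall l, l1pos l -> E l = lzero -> l = lzero) /\
    (forall l, is_l1 l -> E (lstar l) = lstar (E l)) /\
    norm_one E /\
    (forall a l, comm1 a -> is_l1 l ->
       E (lmul a l) = lmul a (E l) /\ E (lmul l a) = lmul (E l) a) /\
    E @` is_c00 = comm00 /\
    (forall phi, is_state phi -> forall l, l1pos l -> 0 <= phi (E l)).

End Crossed.

(* Main.v *)
Require Import Defs.
From HB Require Import structures.
From mathcomp Require Import all_boot all_order all_algebra.
From mathcomp Require Import all_classical all_reals all_analysis.
From mathcomp Require Import complex.
From mathcomp Require Import zify ring lra.
Import Order.TTheory GRing.Theory Num.Theory.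
Import numFieldNormedType.Exports.
Local Open Scope ring_scope.
Local Open Scope classical_set_scope.

(* By Urysohn's lemma, l commutes with C(X) iff each l_n vanishes off Fix_n^o.

   (1), (2) => (3): the k-th coefficient of E'(delta^k) vanishes off Fix_k^o, and
   the module property tested on the functions f supported in Fix_k^o shows that it
   is 1 on Fix_k^o; so Fix_k^o has a continuous indicator function.

   (3) => (4): put E'(l)_n = 1_{Fix_n^o} l_n. Everything but positivity is checked
   pointwise, using that for each x the set {n | x in Fix_n^o} is a subgroup of Z
   which depends only on the orbit of x. For positivity let phi be a state. If h in
   the commutant is self-adjoint of norm at most 1, then 1 - h = (1 - b)^2 for a
   self-adjoint b, so that phi is continuous. For finitely supported l, grouping the
   coefficients of l by the cosets of that subgroup writes E'(l^* l) as a finite sum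
   of squares in the commutant; truncation and continuity give the general case. *)

Set Implicit Arguments.
Unset Strict Implicit.
Unset Printing Implicit Defensive.

Import ComplexField.Normc.

(** * Complex limits with real error bounds *)

Section ComplexSequences.
Context {R : realType}.
Implicit Types (x y z : R[i]) (u : nat -> R[i]).

(** A state is only an algebraic positive functional on an algebra whose norm need not be a C*-norm,
    so square roots have to be made inside l^1. The equation (1 - b)^2 = 1 - h reads b = (h + b^2) /
    2; iterating from 0, increments are dominated coefficientwise by those of the same iteration on
    real sequences, whose mass stays below 1 because (1 + 1) / 2 = 1. Real majorants independent of
    x serve throughout: they give convergence at each point and continuity in x together.

    E(l^* l) need not be a single square. Let G_x be the subgroup attached to x. Since delta is
    unitary, l may be replaced by delta^{-j} l without changing l^* l, but E(delta^{-j} l) sees only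
    the coset j + G_x, so all cosets are needed. As G_x varies with x and may have infinitely many
    cosets, the squares are indexed by integers j in a finite window, each coset being counted with
    its multiplicity and divided by it. By (3) these multiplicities are locally constant, since a
    finite window involves finitely many sets Fix_k^o. *)

Lemma normcE x : `|x| = (normc x)%:C%C.
Proof. by case: x. Qed.

Lemma normc_ge0 x : 0 <= normc x.
Proof. by case: x => a b; exact: sqrtr_ge0. Qed.

Lemma normc_conjc x : normc (conjc x) = normc x.
Proof. by case: x => a b /=; rewrite sqrrN. Qed.

Lemma normc_real (a : R) : normc (a%:C)%C = `|a|.
Proof. by rewrite /= expr0n /= addr0 sqrtr_sqr. Qed.

Lemma normc_distC x y : normc (x - y) = normc (y - x).
Proof. by rewrite -normcN opprB. Qed.

Lemma normc_Re x : `|complex.Re x| <= normc x.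
Proof.
case: x => a b /=; rewrite -[leLHS]ger0_norm ?normr_ge0// -sqrtr_sqr.
by rewrite ler_sqrt ?sqr_ge0 ?addr_ge0 ?sqr_ge0// real_normK ?num_real// lerDl sqr_ge0.
Qed.

Lemma normc_Im x : `|complex.Im x| <= normc x.
Proof.
case: x => a b /=; rewrite -[leLHS]ger0_norm ?normr_ge0// -sqrtr_sqr.
by rewrite ler_sqrt ?sqr_ge0 ?addr_ge0 ?sqr_ge0// real_normK ?num_real// lerDr sqr_ge0.
Qed.

Lemma normc_le_ReIm x : normc x <= `|complex.Re x| + `|complex.Im x|.
Proof.
rewrite [x in normc x]complexE; apply: (le_trans (le_normcD _ _)).
rewrite normcM !normc_real lerD2l //.
by rewrite /normc /= expr0n /= expr1n add0r sqrtr1 mul1r.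
Qed.

(** Radii in [R[i]] are themselves complex; a positive one has zero imaginary part, which reduces
    neighbourhoods to real radii. *)
Lemma cvgcP (T : Type) (F : set_system T) {FF : Filter F} (f : T -> R[i]) (y : R[i]) :
  f @ F --> y <-> forall e : R, 0 < e -> \forall t \near F, normc (y - f t) < e.
Proof.
split=> [/(@cvgrPdist_lt R[i] R[i]^o) h e e0|h].
  have := h (e%:C)%C; rewrite ltcR => /(_ e0); apply: filterS => t.
  by rewrite normcE ltcR.
apply/(@cvgrPdist_lt R[i] R[i]^o) => -[e i]; rewrite ltcE /= => /andP[/eqP -> e0].
have := h e e0; apply: filterS => t.
by rewrite normcE -[Complex e 0]/((e%:C)%C) ltcR.
Qed.

Lemma cvgcD (T : Type) (F : set_system T) {FF : Filter F} (f g : T -> R[i]) y z :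
  f @ F --> y -> g @ F --> z -> (fun t => f t + g t) @ F --> y + z.
Proof.
move=> /cvgcP hf /cvgcP hg; apply/cvgcP => e e0.
have e2 : 0 < e / 2 by rewrite divr_gt0.
near=> t.
rewrite opprD addrACA; apply: (le_lt_trans (le_normcD _ _)).
by rewrite (splitr e) ltrD//; near: t; [exact: hf|exact: hg].
Unshelve. all: by end_near. Qed.

Lemma cvgcM (T : Type) (F : set_system T) {FF : Filter F} (f g : T -> R[i]) y z :
  f @ F --> y -> g @ F --> z -> (fun t => f t * g t) @ F --> y * z.
Proof. exact: (@cvgM R[i] T F FF f g y z). Qed.

Lemma lim_cplx u y : u @ \oo --> y -> limn u = y.
Proof. by move=> h; apply: cvg_lim => //; exact: (@norm_hausdorff R[i] R[i]^o). Qed.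

Lemma cvgn_Complex (a b : nat -> R) (p q : R) :
  a @ \oo --> p -> b @ \oo --> q -> (fun n => (a n +i* b n)%C) @ \oo --> (p +i* q)%C.
Proof.
move=> /cvgrPdist_lt ha /cvgrPdist_lt hb; apply/cvgcP => e e0.
have e2 : 0 < e / 2 by rewrite divr_gt0.
near=> n; apply: (le_lt_trans (normc_le_ReIm _)); rewrite /=.
by rewrite (splitr e) ltrD//; near: n; [exact: ha|exact: hb].
Unshelve. all: by end_near. Qed.

Lemma normc_lim_le u y z (a : R) :
  u @ \oo --> y -> (\forall n \near \oo, normc (u n - z) <= a) -> normc (y - z) <= a.
Proof.
move=> /cvgcP h hu; apply/ler_addgt0Pr => e e0.
have [n [h1 h2]] : exists n, normc (y - u n) < e /\ normc (u n - z) <= a.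
  by apply: (@filter_ex _ (nbhs (\oo : set_system nat)));
     apply: filterI; [exact: h|].
rewrite -(subrKA (u n)) addrC; apply: (le_trans (le_normcD _ _)).
by rewrite lerD// ltW.
Qed.

Lemma dominated_cvgn u (B : nat -> R) (A : R) :
  (forall n m, (n <= m)%N -> normc (u m - u n) <= B m - B n) ->
  (forall n, B n <= A) ->
  [/\ cvgn u, cvgn B & forall n, normc (limn u - u n) <= limn B - B n].
Proof.
move=> hu hB.
have Bnd : nondecreasing_seq B.
  by move=> n m nm; rewrite -subr_ge0; apply: le_trans (hu _ _ nm); exact: normc_ge0.
have cB : cvgn B by apply: nondecreasing_is_cvgn => //; exists A => _ [n _ <-].
have crd (g : R[i] -> R) : {morph g : x y / x - y} -> (forall x, `|g x| <= normc x) ->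
    cvgn (g \o u).
  move=> gB gn.
  (* [g (u n) + B n] is nondecreasing, since [g \o u] never drops by more than [B] grows; monotone
     convergence of real sequences then suffices. *)
  have -> : g \o u = (fun n => (g (u n) + B n) - B n) by apply/funext => n /=; rewrite addrK.
  apply: is_cvgB => //; apply: nondecreasing_is_cvgn.
    move=> n m nm; have := le_trans (gn _) (hu _ _ nm); rewrite gB distrC.
    by move=> /(le_trans (ler_norm _)) /=; lra.
  exists (g (u 0%N) + A - B 0%N + A) => _ [n _ <-]; rewrite lerD//.
  have := le_trans (gn _) (hu _ _ (leq0n n)); rewrite gB.
  by move=> /(le_trans (ler_norm _)); have := hB n; lra.
have cRe : cvgn ((@complex.Re R) \o u) by apply: crd => [[? ?] [? ?]|] //; exact: normc_Re.
have cIm : cvgn ((@complex.Im R) \o u) by apply: crd => [[? ?] [? ?]|] //; exact: normc_Im.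
have cu : u @ \oo --> (limn ((@complex.Re R) \o u) +i* limn ((@complex.Im R) \o u))%C.
  have := cvgn_Complex cRe cIm; apply: cvg_trans; apply: near_eq_cvg.
  by near=> n; rewrite /=; case: (u n).
split; [by apply/cvg_ex; eexists; exact: cu|exact: cB|].
move=> n; rewrite (lim_cplx cu); apply: (normc_lim_le cu).
near=> m; apply: (le_trans (hu n m _)); first by near: m; exact: nbhs_infty_ge.
by rewrite lerD2r; exact: nondecreasing_cvgn_le.
Unshelve. all: by end_near. Qed.

End ComplexSequences.

(** * Symmetric sums over the integers and convolution of majorants *)

Section IntegerSums.
Context {R : realType}.
Implicit Types (u v : int -> R[i]) (U V : int -> R).

(** The expression under the limit in [zsum], with a general codomain so as to cover complex
    families and their real majorants alike. *)
Definition psum {V : nmodType} (u : int -> V) (N : nat) : V :=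
  \sum_(i < (N + N).+1) u (i%:Z - N%:Z).

(* Locked because [inE] would otherwise see through it to the underlying list. *)
Definition win (N : nat) : seq int := locked [seq i%:Z - N%:Z | i <- iota 0 (N + N).+1].

Lemma psumE {V : nmodType} (u : int -> V) N : psum u N = \sum_(k <- win N) u k.
Proof. by rewrite /psum /win -lock big_map (_ : iota 0 _ = index_iota 0 (N + N).+1) ?big_mkord. Qed.

Lemma win_uniq N : uniq (win N).
Proof. by rewrite /win -lock map_inj_uniq ?iota_uniq// => i j /addIr[]. Qed.

Lemma mem_win N k : (k \in win N) = (`|k| <= N)%N.
Proof.
rewrite /win -lock; apply/mapP/idP => [[m]|kN].
  by rewrite mem_iota => /andP[_ mN] ->; lia.
exists `|(k + N%:Z)%R|%N; last by lia.
by rewrite mem_iota; lia.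
Qed.


Lemma psumS {V : nmodType} (u : int -> V) N :
  psum u N.+1 = psum u N + (u N.+1%:Z + u (- N.+1%:Z)).
Proof.
rewrite !psumE (perm_big (N.+1%:Z :: - N.+1%:Z :: win N)).
  by rewrite /= !big_cons addrA addrC.
apply: uniq_perm; [exact: win_uniq|rewrite 2!cons_uniq win_uniq !inE !mem_win; lia|].
by move=> k; rewrite !inE !mem_win; lia.
Qed.

Lemma psumD {V : nmodType} (u v : int -> V) N :
  psum (fun k => u k + v k) N = psum u N + psum v N.
Proof. by rewrite /psum big_split. Qed.

Lemma psumZ {A : pzRingType} (a : A) (u : int -> A) N :
  psum (fun k => a * u k) N = a * psum u N.
Proof. by rewrite /psum mulr_sumr. Qed.

Lemma psumN {V : zmodType} (u : int -> V) N : psum (fun k => - u k) N = - psum u N.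
Proof. by rewrite /psum sumrN. Qed.

Lemma psum_opp {V : nmodType} (u : int -> V) N : psum (fun k => u (- k)) N = psum u N.
Proof.
rewrite !psumE -(big_map -%R predT u); apply: perm_big; apply: uniq_perm.
- by rewrite map_inj_uniq ?win_uniq//; exact: oppr_inj.
- exact: win_uniq.
move=> k; rewrite -[k in LHS]opprK mem_map; last exact: oppr_inj.
by rewrite !mem_win abszN.
Qed.

Lemma ler_psum U V N : (forall k, U k <= V k) -> psum U N <= psum V N.
Proof. by move=> h; apply: ler_sum. Qed.

Lemma psum_ge0 U N : (forall k, 0 <= U k) -> 0 <= psum U N.
Proof. by move=> h; apply: sumr_ge0. Qed.

Lemma normc_psum_diff u U N M : (forall k, normc (u k) <= U k) -> (N <= M)%N ->
  normc (psum u M - psum u N) <= psum U M - psum U N.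
Proof.
move=> h /subnK <-; elim: (M - N)%N => [|m IH]; first by rewrite add0n !subrr normc0.
rewrite addSn !psumS [_ + _ - psum u N]addrAC [_ + _ - psum U N]addrAC.
apply: (le_trans (le_normcD _ _)); rewrite lerD//.
by apply: (le_trans (le_normcD _ _)); rewrite lerD.
Qed.

Definition zr U : R := limn (psum U).

(** For nonnegative [U]: summability, with an explicit bound on the total mass. *)
Definition bsum U A := forall N, psum U N <= A.

Lemma psum_nd U : (forall k, 0 <= U k) -> nondecreasing_seq (psum U).
Proof.
by move=> h; apply/nondecreasing_seqP => n; rewrite psumS lerDl addr_ge0.
Qed.

Lemma zr_cvg U A : (forall k, 0 <= U k) -> bsum U A -> psum U @ \oo --> zr U.
Proof.
move=> h b; apply: nondecreasing_is_cvgn; first exact: psum_nd.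
by exists A => _ [n _ <-].
Qed.

Lemma psum_le_zr U A N : (forall k, 0 <= U k) -> bsum U A -> psum U N <= zr U.
Proof. by move=> h b; apply: nondecreasing_cvgn_le; [exact: psum_nd|exact: zr_cvg h b]. Qed.

Lemma zr_le U A : (forall k, 0 <= U k) -> bsum U A -> zr U <= A.
Proof. by move=> h b; apply: limr_le; [exact: zr_cvg h b|exact: nearW]. Qed.

Lemma zr_ge0 U A : (forall k, 0 <= U k) -> bsum U A -> 0 <= zr U.
Proof. by move=> h b; apply: le_trans (psum_le_zr 0 h b); exact: psum_ge0. Qed.

Lemma bsum_zr U A : (forall k, 0 <= U k) -> bsum U A -> bsum U (zr U).
Proof. by move=> h b N; exact: psum_le_zr h b. Qed.

Lemma bsum_le U V A : (forall k, U k <= V k) -> bsum V A -> bsum U A.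
Proof. by move=> h b N; apply: le_trans (b N); exact: ler_psum. Qed.

Lemma zrB U V A : (forall k, 0 <= U k) -> (forall k, U k <= V k) -> bsum V A ->
  zr (fun k => V k - U k) = zr V - zr U.
Proof.
move=> U0 UV b; apply: cvg_lim => //.
have -> : psum (fun k => V k - U k) = (fun N => psum V N - psum U N).
  by apply/funext => N; rewrite psumD psumN.
apply: cvgB; last exact: zr_cvg U0 (bsum_le UV b).
by apply: zr_cvg b => k; exact: le_trans (UV k).
Qed.

Lemma zrD U V A B : (forall k, 0 <= U k) -> (forall k, 0 <= V k) -> bsum U A -> bsum V B ->
  zr (fun k => U k + V k) = zr U + zr V.
Proof.
move=> U0 V0 bU bV; apply: cvg_lim => //.
have -> : psum (fun k => U k + V k) = (fun N => psum U N + psum V N).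
  by apply/funext => N; rewrite psumD.
by apply: cvgD; [exact: zr_cvg bU|exact: zr_cvg bV].
Qed.

Lemma bsum_opp U A : bsum U A -> bsum (fun k => U (- k)) A.
Proof. by move=> b N; rewrite psum_opp. Qed.

Lemma bsum_seq U A (r : seq int) : (forall k, 0 <= U k) -> bsum U A -> uniq r ->
  \sum_(k <- r) U k <= A.
Proof.
move=> h b ur; pose N := (\max_(k <- r) `|k|)%N.
apply: le_trans (b N); rewrite psumE [leRHS](bigID (mem r))/=.
rewrite -[leLHS]addr0 lerD ?sumr_ge0//.
rewrite -[leRHS]big_filter (perm_big [seq k <- win N | k \in r])//.
apply: uniq_perm => //; first by rewrite filter_uniq ?win_uniq.
move=> k; rewrite mem_filter mem_win; case: (boolP (k \in r)) => //= kr.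
by rewrite /N (big_rem k)//= leq_maxl.
Qed.

Lemma bsum_term U A k : (forall k, 0 <= U k) -> bsum U A -> U k <= A.
Proof. by move=> h b; have := @bsum_seq U A [:: k] h b isT; rewrite big_seq1. Qed.

(** The error bound involves the majorant alone, so for a family depending on a point it is uniform;
    continuity of sums rests on this. *)
Lemma dominated_zsum u U A : (forall k, normc (u k) <= U k) -> bsum U A ->
  psum u @ \oo --> zsum u /\ forall N, normc (zsum u - psum u N) <= zr U - psum U N.
Proof.
move=> h b; have [] := @dominated_cvgn R (psum u) (psum U) A.
- by move=> n m; exact: normc_psum_diff.
- exact: b.
by move=> c _ e; split; [exact: c|exact: e].
Qed.

Lemma zsum_cvg u U A : (forall k, normc (u k) <= U k) -> bsum U A ->
  psum u @ \oo --> zsum u.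
Proof. by move=> h b; case: (dominated_zsum h b). Qed.

Lemma normc_psum u U N : (forall k, normc (u k) <= U k) -> normc (psum u N) <= psum U N.
Proof.
move=> h; elim: N => [|N IH]; first by rewrite /psum !big_ord1.
rewrite !psumS; apply: (le_trans (le_normcD _ _)); rewrite lerD//.
by apply: (le_trans (le_normcD _ _)); rewrite lerD.
Qed.

Lemma normc_zsum u U A : (forall k, normc (u k) <= U k) -> bsum U A ->
  normc (zsum u) <= zr U.
Proof.
move=> h b; have U0 k : 0 <= U k by apply: le_trans (h k); exact: normc_ge0.
rewrite -[zsum u]subr0; apply: (normc_lim_le (zsum_cvg h b)).
near=> n; rewrite subr0; apply: (le_trans (normc_psum n h)).
exact: psum_le_zr b.
Unshelve. all: by end_near. Qed.

Lemma zsum_lim u (z : R[i]) : psum u @ \oo --> z -> zsum u = z.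
Proof. exact: lim_cplx. Qed.

Lemma zsum_lin (a b : R[i]) u v : psum u @ \oo --> zsum u -> psum v @ \oo --> zsum v ->
  zsum (fun k => a * u k + b * v k) = a * zsum u + b * zsum v.
Proof.
move=> cu cv; apply: zsum_lim.
have -> : psum (fun k => a * u k + b * v k) = (fun N => a * psum u N + b * psum v N).
  by apply/funext => N; rewrite psumD !psumZ.
by apply: cvgcD; apply: cvgcM; [exact: cvg_cst|exact: cu|exact: cvg_cst|exact: cv].
Qed.

Lemma zsumB u v : psum u @ \oo --> zsum u -> psum v @ \oo --> zsum v ->
  zsum (fun k => u k - v k) = zsum u - zsum v.
Proof.
move=> cu cv; have := zsum_lin 1 (-1) cu cv; rewrite mul1r mulN1r => <-.
by congr zsum; apply/funext => k; rewrite mul1r mulN1r.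
Qed.

Lemma psum_cvg_seq u (r : seq int) : uniq r -> (forall k, k \notin r -> u k = 0) ->
  psum u @ \oo --> \sum_(k <- r) u k.
Proof.
move=> ur h; apply: cvg_near_cst; near=> M.
have rM : {subset r <= win M}.
  have hM : (\max_(k <- r) `|k| <= M)%N by near: M; exact: nbhs_infty_ge.
  move=> k kr; rewrite mem_win; apply: leq_trans hM.
  by rewrite (big_rem k)//= leq_maxl.
rewrite psumE (bigID (mem r))/= [X in _ + X]big1 ?addr0; last by move=> k; exact: h.
rewrite -big_filter; apply: perm_big; apply: uniq_perm => //.
  by rewrite filter_uniq ?win_uniq.
by move=> k; rewrite mem_filter andb_idr//; exact: rM.
Unshelve. all: by end_near. Qed.

Lemma zsum_seq u (r : seq int) : uniq r -> (forall k, k \notin r -> u k = 0) ->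
  zsum u = \sum_(k <- r) u k.
Proof. by move=> ur h; apply: zsum_lim; exact: psum_cvg_seq. Qed.

Lemma psum_cvg1 u k0 : (forall k, k != k0 -> u k = 0) -> psum u @ \oo --> zsum u.
Proof.
move=> h; have h1 k : k \notin [:: k0] -> u k = 0 by rewrite inE; exact: h.
by rewrite (@zsum_seq u [:: k0])//; exact: psum_cvg_seq.
Qed.

Lemma zsum1 u k0 : (forall k, k != k0 -> u k = 0) -> zsum u = u k0.
Proof.
move=> h; rewrite (@zsum_seq _ [:: k0])// ?big_seq1// => k.
by rewrite inE; exact: h.
Qed.

Lemma zsum0 : zsum (fun _ => 0 : R[i]) = 0. Proof. exact: (@zsum1 _ 0). Qed.

Lemma zsum_opp u : zsum (fun k => u (- k)) = zsum u.
Proof. by rewrite /zsum; congr (lim (_ @ \oo)); apply/funext => N; exact: psum_opp. Qed.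

Lemma conjc_zsum u U A : (forall k, normc (u k) <= U k) -> bsum U A ->
  conjc (zsum u) = zsum (fun k => conjc (u k)).
Proof.
move=> h b; apply/esym/zsum_lim/cvgcP => e e0.
have /cvgcP/(_ e e0) := zsum_cvg h b; apply: filterS => N.
by rewrite /psum -rmorph_sum -rmorphB normc_conjc.
Qed.

(** The terms are real, so the sum is a real series of nonnegative terms and bounds each of them. *)
Lemma zsum_ge0 u U A : (forall k, normc (u k) <= U k) -> bsum U A ->
  (forall k, 0 <= u k) -> 0 <= zsum u /\ (zsum u = 0 -> forall k, u k = 0).
Proof.
move=> h b u0; pose v k := complex.Re (u k).
have uv k : u k = (v k)%:C%C.
  by have := u0 k; rewrite /v; case: (u k) => x y; rewrite lecE /= => /andP[/eqP -> _].
have v0 k : 0 <= v k by rewrite -ler0c -uv.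
have bv : bsum v A.
  apply: bsum_le b => k; apply: le_trans (h k); rewrite uv normc_real ger0_norm//.
have e : zsum u = (zr v)%:C%C.
  apply: zsum_lim; apply/cvgcP => e e0.
  have /cvgrPdist_lt/(_ e e0) := zr_cvg v0 bv; apply: filterS => N.
  have -> : psum u N = (psum v N)%:C%C by rewrite /psum rmorph_sum; apply: eq_bigr.
  by rewrite -rmorphB normc_real.
rewrite e ler0c; split; first exact: zr_ge0 bv.
move=> [z0] k; rewrite uv; congr (_%:C)%C; apply/eqP; rewrite eq_le v0 andbT.
by rewrite -z0; apply: bsum_term => //; exact: bsum_zr bv.
Qed.

Lemma cvgn_psum (f : int -> nat -> R) U N : (forall k, f k @ \oo --> U k) ->
  (fun j => psum (fun k => f k j) N) @ \oo --> psum U N.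
Proof.
move=> h; elim: N => [|N IH].
  by rewrite /psum big_ord1; under eq_fun do rewrite big_ord1; exact: h.
rewrite psumS; under eq_fun do rewrite psumS.
by apply: cvgD => //; exact: cvgD.
Qed.

Definition conv U V (n : int) : R := zr (fun k => U k * V (n - k)).

Section Convolution.
Variables (U V : int -> R) (A B : R).
Hypotheses (U0 : forall k, 0 <= U k) (V0 : forall k, 0 <= V k).
Hypotheses (bU : bsum U A) (bV : bsum V B).

Lemma conv_term_ge0 n k : 0 <= U k * V (n - k).
Proof. exact: mulr_ge0. Qed.

Lemma bsum_conv_term n : bsum (fun k => U k * V (n - k)) (A * B).
Proof.
move=> N; apply: (@le_trans _ _ (psum (fun k => B * U k) N)).
  by apply: ler_psum => k; rewrite mulrC ler_wpM2r// bsum_term.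
rewrite psumZ mulrC ler_wpM2r//.
by apply: le_trans (bV 0); exact: psum_ge0.
Qed.

Lemma conv_ge0 n : 0 <= conv U V n.
Proof. exact: zr_ge0 (conv_term_ge0 n) (bsum_conv_term n). Qed.

Lemma bsum_conv : bsum (conv U V) (A * B).
Proof.
move=> N.
have cc : (fun K => psum (fun n => psum (fun k => U k * V (n - k)) K) N) @ \oo
     --> psum (conv U V) N.
  by apply: cvgn_psum => n; exact: zr_cvg (conv_term_ge0 n) (bsum_conv_term n).
rewrite -(cvg_lim _ cc)//; apply: limr_le; first exact: cvgP cc.
apply: nearW => K.
(* With the inner sum cut off at [K] both sums are finite and can be exchanged. For each [k] the sum
   of [V] then runs over a translated window, which is why [bsum_seq] admits arbitrary
   duplicate-free lists. *)
rewrite psumE; under eq_bigr do rewrite psumE; rewrite exchange_big/=.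
have B0 : 0 <= B by apply: le_trans (bV 0); exact: psum_ge0.
apply: (@le_trans _ _ (\sum_(k <- win K) U k * B)).
  apply: ler_sum => k _; rewrite -mulr_sumr ler_wpM2l//.
  rewrite -(big_map (fun n => n - k) predT V); apply: bsum_seq => //.
  by rewrite map_inj_uniq ?win_uniq//; exact: addIr.
by rewrite -mulr_suml ler_wpM2r// -psumE.
Qed.

End Convolution.

End IntegerSums.

(** * Iterates of sigma and the interiors of their fixed-point sets *)

Section Dynamics.
Variables (X : topologicalType) (s si : X -> X).
Hypotheses (sK : cancel s si) (siK : cancel si s) (cs : continuous s) (csi : continuous si).
Local Notation sg := (sigp s si).
Local Notation fixo k := (interior (Fixk s si k)).

Lemma sigpS k x : sg (k + 1) x = s (sg k x).
Proof.
case: k => [n|[|n]]; first by rewrite -PoszD addn1.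
  by rewrite (_ : Negz 0 + 1 = 0) //= siK.
by rewrite (_ : Negz n.+1 + 1 = Negz n) ?[in RHS]/= ?siK//; lia.
Qed.

Lemma sigpB1 k x : sg (k - 1) x = si (sg k x).
Proof. by rewrite -[in RHS](subrK 1 k) sigpS sK. Qed.

Lemma sigpD j k x : sg (j + k) x = sg j (sg k x).
Proof.
elim: j => [|n IH|n IH]; first by rewrite add0r.
- by rewrite -addn1 PoszD addrAC !sigpS IH.
- by rewrite -addn1 PoszD opprD addrAC !sigpB1 IH.
Qed.

Lemma sigpNK k x : sg (- k) (sg k x) = x.
Proof. by rewrite -sigpD addNr. Qed.

Lemma sigpK k x : sg k (sg (- k) x) = x.
Proof. by rewrite -sigpD addrN. Qed.

Lemma sigpC j k x : sg j (sg k x) = sg k (sg j x).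
Proof. by rewrite -!sigpD addrC. Qed.

Lemma continuous_sigp k : continuous (sg k).
Proof.
have it (f : X -> X) n : continuous f -> continuous (iter n f).
  move=> cf; elim: n => [|n IH] x; first exact: cvg_id.
  by apply: (@continuous_comp _ _ _ (iter n f) f); [exact: IH|exact: cf].
by case: k => n; [exact: it cs|exact: (it _ n.+1 csi)].
Qed.

Lemma fixo_sigp k x : fixo k x -> sg k x = x.
Proof. by move=> /interior_subset. Qed.

Lemma fixoN k x : fixo k x -> fixo (- k) x.
Proof. by apply: interiorS => y /= e; rewrite /Fixk/= -{1}e sigpNK. Qed.

Lemma fixoNE k x : fixo (- k) x <-> fixo k x.
Proof. by split => [/fixoN|/fixoN//]; rewrite opprK. Qed.

Lemma fixoD j k x : fixo j x -> fixo k x -> fixo (j + k) x.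
Proof.
move=> hj hk; have : interior (Fixk s si j `&` Fixk s si k) x by rewrite interiorI.
by apply: interiorS => y [/= ej ek]; rewrite /Fixk/= sigpD ek.
Qed.

Lemma fixoDE j k x : fixo k x -> fixo (j + k) x <-> fixo j x.
Proof.
move=> hk; split=> [hj|hj]; last exact: fixoD.
by rewrite -(addrK k j); apply: fixoD => //; exact: fixoN.
Qed.

Lemma fixo0 x : fixo 0 x.
Proof. by rewrite /interior (_ : Fixk _ _ _ = setT); [exact: filterT|apply/seteqP; split]. Qed.

(** [sg (- j)] is continuous, so a neighbourhood of [x] fixed by [sg k] pulls back to one of
    [sg j x], and the two iterates commute. *)
Lemma fixo_orbit k j x : fixo k x -> fixo k (sg j x).
Proof.
move=> hx; have h : nbhs (sg j x) (fun y => Fixk s si k (sg (- j) y)).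
  by apply: (@continuous_sigp (- j) (sg j x)); rewrite /= sigpNK.
apply: filterS h => y /=.
by rewrite /Fixk/= sigpC => /(can_inj (sigpK j)).
Qed.

Lemma fixo_orbitE k j x : fixo k (sg j x) <-> fixo k x.
Proof. by split=> [/(fixo_orbit (- j))|/fixo_orbit//]; rewrite sigpNK. Qed.

End Dynamics.

(** * The l^1 algebra through majorants, and the commutant of C(X) *)

Section L1.
Variables (R : realType) (X : topologicalType) (s si : X -> X).
Hypotheses (hX : hausdorff_space X) (cX : compact [set: X]) (X0 : [set: X] !=set0).
Hypotheses (sK : cancel s si) (siK : cancel si s) (cs : continuous s) (csi : continuous si).
Local Notation C := (R[i]).
Local Notation Sq := (int -> X -> C).
Local Notation sg := (sigp s si).
Local Notation fixo k := (interior (Fixk s si k)).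
Local Notation lmul := (lmul s si).
Local Notation lstar := (lstar s si).
Implicit Types (f g : X -> C) (l m : Sq) (U V : int -> R).

Lemma normc_subr (x y : C) : `|normc x - normc y| <= normc (x - y).
Proof.
have h (a b : C) : normc a <= normc (a - b) + normc b.
  by rewrite -{1}(subrK b a); exact: le_normcD.
by rewrite ler_norml; have := h x y; have := h y x; rewrite (normc_distC y); lra.
Qed.

Lemma continuous_normc f : continuous f -> continuous (fun x => normc (f x)).
Proof.
move=> cf x; apply/cvgrPdist_lt => e e0.
have /cvgcP/(_ e e0) := cf x; apply: filterS => y.
exact: le_lt_trans (normc_subr _ _).
Qed.

Lemma normc_image_has_sup f : continuous f -> has_sup [set normc (f x) | x in [set: X]].
Proof.
move=> cf; apply: compact_has_sup; first exact: image_nonempty.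
by apply: continuous_compact => //; apply: continuous_subspaceT; exact: continuous_normc.
Qed.

Lemma normc_le_supn f x : continuous f -> normc (f x) <= supn f.
Proof. by move=> cf; apply: sup_upper_bound; [exact: normc_image_has_sup|exists x]. Qed.

Lemma supn_le f a : (forall x, normc (f x) <= a) -> supn f <= a.
Proof. by move=> h; apply: ge_sup; [exact: image_nonempty|move=> _ [x _ <-]]. Qed.

Lemma supn_ge0 f : continuous f -> 0 <= supn f.
Proof. by case: X0 => x _ cf; apply: le_trans (normc_le_supn x cf); exact: normc_ge0. Qed.

Lemma supn_cst (a : C) : supn (fun _ : X => a) = normc a.
Proof.
apply/eqP; rewrite eq_le supn_le//=; case: X0 => x _.
by rewrite (@normc_le_supn (fun=> a) x)//; exact: cst_continuous.
Qed.

Lemma esum_leP U A : (forall k, 0 <= U k) ->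
  (\esum_(k in [set: int]) (U k)%:E <= A%:E)%E <-> bsum U A.
Proof.
move=> U0; split=> [h N|b].
  rewrite -lee_fin; apply: le_trans h; apply: esum_ge.
  exists [set` win N]; first by split=> //; exact: finite_seq.
  by rewrite -fsbig_seq ?win_uniq// psumE sumEFin.
apply: ge_ereal_sup => _ [F [finF _] <-].
rewrite fsbig_finite//= sumEFin lee_fin.
by apply: bsum_seq; rewrite ?finmap.fset_uniq.
Qed.

(** With its converse [l1_major], this trades the extended-real norm for a majorant independent of
    the point, the form in which all algebra operations are estimated. *)
Lemma major_l1 l U A : (forall k, continuous (l k)) ->
  (forall k x, normc (l k x) <= U k) -> bsum U A -> is_l1 l.
Proof.
move=> cl h b; split=> //; apply: (@le_lt_trans _ _ A%:E); last exact: ltry.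
apply/esum_leP; first by move=> k; exact: supn_ge0.
by apply: bsum_le b => k; exact: supn_le.
Qed.

Lemma l1_bsum l : is_l1 l -> bsum (fun k => supn (l k)) (fine (l1norm l)).
Proof.
move=> [cl h]; apply/esum_leP; first by move=> k; exact: supn_ge0.
rewrite fineK// ge0_fin_numE//; apply: esum_ge0 => k _.
by rewrite lee_fin supn_ge0.
Qed.

Lemma l1_major l : is_l1 l -> exists U A, [/\ forall k, 0 <= U k,
  forall k x, normc (l k x) <= U k & bsum U A].
Proof.
move=> hl; exists (fun k => supn (l k)), (fine (l1norm l)); split.
- by move=> k; apply: supn_ge0; exact: hl.1.
- by move=> k x; apply: normc_le_supn; exact: hl.1.
- exact: l1_bsum.
Qed.

Lemma continuous_mulc f g : continuous f -> continuous g -> continuous (fun x => f x * g x).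
Proof. by move=> cf cg x; apply: cvgcM; [exact: cf|exact: cg]. Qed.

Lemma continuous_addc f g : continuous f -> continuous g -> continuous (fun x => f x + g x).
Proof. by move=> cf cg x; apply: cvgcD; [exact: cf|exact: cg]. Qed.

Lemma continuous_conjc f : continuous f -> continuous (fun x => conjc (f x)).
Proof.
move=> cf x; apply/cvgcP => e e0.
have /cvgcP/(_ e e0) := cf x; apply: filterS => y.
by rewrite -rmorphB normc_conjc.
Qed.

Lemma continuous_comp_sigp f k : continuous f -> continuous (fun x => f (sg k x)).
Proof.
move=> cf x; apply: (@continuous_comp _ _ _ (sg k) f); last exact: cf.
exact: continuous_sigp.
Qed.

Lemma continuous_uniform_limit f (g : nat -> X -> C) (e : nat -> R) :
  (forall n, continuous (g n)) -> (forall n x, normc (f x - g n x) <= e n) ->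
  e @ \oo --> 0 -> continuous f.
Proof.
move=> cg h e0 x; apply/cvgcP => d d0.
have d3 : 0 < d / 3 by rewrite divr_gt0.
have [n hn] : exists n, e n < d / 3.
  have /cvgrPdist_lt/(_ _ d3) := e0; move=> /filter_ex[n].
  by rewrite sub0r normrN => hn; exists n; exact: le_lt_trans (ler_norm _) hn.
have /cvgcP/(_ _ d3) := cg n x; apply: filterS => y hy.
have -> : f x - f y = (f x - g n x) + (g n x - g n y) + (g n y - f y) by rewrite !subrKA.
have h1 := le_normcD (f x - g n x + (g n x - g n y)) (g n y - f y).
have h2 := le_normcD (f x - g n x) (g n x - g n y).
have := h n x; have := h n y; rewrite (normc_distC (f y)); lra.
Qed.

Lemma continuous_psum (u : int -> X -> C) N : (forall k, continuous (u k)) ->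
  continuous (fun x => psum (fun k => u k x) N).
Proof.
move=> cu; elim: N => [|N IH].
  by under eq_fun do rewrite /psum big_ord1; exact: cu.
under eq_fun do rewrite psumS.
by apply: continuous_addc; [exact: IH|apply: continuous_addc; exact: cu].
Qed.

Lemma continuous_zsum (u : int -> X -> C) U A : (forall k, continuous (u k)) ->
  (forall k x, normc (u k x) <= U k) -> bsum U A ->
  continuous (fun x => zsum (fun k => u k x)).
Proof.
move=> cu h b; have U0 k : 0 <= U k.
  by case: X0 => x _; apply: le_trans (h k x); exact: normc_ge0.
apply: (@continuous_uniform_limit _ (fun N x => psum (fun k => u k x) N)
  (fun N => zr U - psum U N)).
- by move=> n; exact: continuous_psum.
- by move=> n x; have [_] := @dominated_zsum _ (fun k => u k x) U A (fun k => h k x) b; exact.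
- by rewrite -(subrr (zr U)); apply: cvgB; [exact: cvg_cst|exact: zr_cvg b].
Qed.

Section Products.
Variables (l m : Sq) (U V : int -> R) (A B : R).
Hypotheses (U0 : forall k, 0 <= U k) (V0 : forall k, 0 <= V k).
Hypotheses (lU : forall k x, normc (l k x) <= U k) (mV : forall k x, normc (m k x) <= V k).
Hypotheses (bU : bsum U A) (bV : bsum V B).

Lemma lmul_term_le n x k : normc (l k x * alphak s si k (m (n - k)) x) <= U k * V (n - k).
Proof. by rewrite normcM ler_pM ?normc_ge0 ?lU /alphak ?mV. Qed.

Lemma lmul_cvg n x : psum (fun k => l k x * alphak s si k (m (n - k)) x) @ \oo --> lmul l m n x.
Proof. exact: zsum_cvg (lmul_term_le n x) (bsum_conv_term U0 V0 bU bV n). Qed.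

Lemma lmul_le n x : normc (lmul l m n x) <= conv U V n.
Proof. exact: normc_zsum (lmul_term_le n x) (bsum_conv_term U0 V0 bU bV n). Qed.

End Products.

Lemma lmul_l1 l m : is_l1 l -> is_l1 m -> is_l1 (lmul l m).
Proof.
move=> hl hm; have [U [A [U0 lU bU]]] := l1_major hl.
have [V [B [V0 mV bV]]] := l1_major hm.
apply: (@major_l1 _ (conv U V) (A * B)); last exact: bsum_conv.
  move=> n; apply: (@continuous_zsum
    (fun k x => l k x * alphak s si k (m (n - k)) x)).
  - move=> k; apply: continuous_mulc; first exact: hl.1.
    by apply: continuous_comp_sigp; exact: hm.1.
  - by move=> k x; exact: (lmul_term_le lU mV).
  - exact: (bsum_conv_term U0 V0 bU bV).
by move=> n x; exact: (lmul_le U0 V0 lU mV bU bV).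
Qed.

Lemma lstar_l1 l : is_l1 l -> is_l1 (lstar l).
Proof.
move=> hl; have [U [A [U0 lU bU]]] := l1_major hl.
apply: (@major_l1 _ (fun k => U (- k)) A); last exact: bsum_opp.
  by move=> n; apply: continuous_conjc; apply: continuous_comp_sigp; exact: hl.1.
by move=> n x; rewrite normc_conjc /alphak lU.
Qed.

Lemma lscale_l1 (a : C) l : is_l1 l -> is_l1 (lscale a l).
Proof.
move=> hl; have [U [A [U0 lU bU]]] := l1_major hl.
apply: (@major_l1 _ (fun k => normc a * U k) (normc a * A)).
- by move=> n; apply: continuous_mulc; [exact: cst_continuous|exact: hl.1].
- by move=> n x; rewrite normcM ler_wpM2l ?normc_ge0.
- by move=> N; rewrite psumZ ler_wpM2l ?normc_ge0.
Qed.

Lemma ladd_l1 l m : is_l1 l -> is_l1 m -> is_l1 (ladd l m).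
Proof.
move=> hl hm; have [U [A [U0 lU bU]]] := l1_major hl.
have [V [B [V0 mV bV]]] := l1_major hm.
apply: (@major_l1 _ (fun k => U k + V k) (A + B)).
- by move=> n; apply: continuous_addc; [exact: hl.1|exact: hm.1].
- by move=> n x; apply: (le_trans (le_normcD _ _)); exact: lerD.
- by move=> N; rewrite psumD lerD.
Qed.

Lemma fin_l1 l (N : nat) : (forall k, continuous (l k)) ->
  (forall k, (N < `|k|)%N -> l k = (fun _ => 0)) -> is_l1 l.
Proof.
move=> cl h; apply: (@major_l1 _ (fun k => supn (l k)) (psum (fun k => supn (l k)) N)) => //.
  by move=> k x; exact: normc_le_supn.
have s0 k : (N < `|k|)%N -> supn (l k) = 0 by move=> /h ->; rewrite supn_cst normc0.
move=> M; have [MN|/ltnW NM] := leqP M N.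
  by apply: psum_nd => // k; exact: supn_ge0.
rewrite -(subnK NM); elim: (M - N)%N => // d; rewrite addSn psumS.
by rewrite !s0 ?addr0//; lia.
Qed.

Lemma c00_fin l : is_c00 l -> exists N, forall k, (N < `|k|)%N -> l k = (fun _ => 0).
Proof.
move=> [_ /finite_seqP[r er]]; exists (\max_(k <- r) `|k|)%N => k hk.
apply: contrapT => lk; have : [set` r] k by rewrite -er.
by move=> kr; move: hk; rewrite (big_rem k)//= ltnNge leq_maxl.
Qed.

Lemma fin_c00 l (N : nat) : (forall k, continuous (l k)) ->
  (forall k, (N < `|k|)%N -> l k = (fun _ => 0)) -> is_c00 l.
Proof.
move=> cl h; split=> //; apply: (@sub_finite_set _ _ [set` win N]) => // k lk.
by rewrite /= mem_win leqNgt; apply/negP => /h.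
Qed.

Lemma c00_l1 l : is_c00 l -> is_l1 l.
Proof. by move=> hl; have [N] := c00_fin hl; apply: fin_l1; exact: hl.1. Qed.

(* The element f delta^k. *)
Definition monom (k : int) f : Sq := fun n => if n == k then f else (fun _ => 0).

Lemma monom_c00 k f : continuous f -> is_c00 (monom k f).
Proof.
move=> cf; apply: (@fin_c00 _ `|k|%N) => n; rewrite /monom; case: eqP => [e|_].
- exact: cf.
- exact: cst_continuous.
- by rewrite e ltnn.
- by [].
Qed.

Lemma lmul_cst0l f l n x : lmul (cst0 f) l n x = f x * l n x.
Proof.
rewrite /Defs.lmul (@zsum1 _ _ 0) => [|k k0]; last by rewrite /cst0 (negbTE k0) mul0r.
by rewrite /cst0 eqxx /alphak oppr0 subr0.
Qed.

Lemma lmul_cst0r f l n x : lmul l (cst0 f) n x = l n x * f (sg (- n) x).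
Proof.
rewrite /Defs.lmul (@zsum1 _ _ n) => [|k k0].
  by rewrite /cst0 subrr eqxx /alphak.
by rewrite /cst0 /alphak subr_eq0 eq_sym (negbTE k0) mulr0.
Qed.

Lemma urysohn_c (K : set X) x : closed K -> ~ K x ->
  exists f, [/\ continuous f, f x = 1 & forall y, K y -> f y = 0].
Proof.
move=> cK Kx.
have [] := @urysohn_ext_itv X R (compact_normal hX cX) K [set x] 0 1 cK _ _ ltr01.
- by apply: accessible_closed_set1; exact: hausdorff_accessible.
- by apply/seteqP; split=> // y [Ky /= e]; apply: Kx; rewrite -e.
move=> f [cf f0 f1 _]; exists (fun y => (f y)%:C%C); split.
- move=> y; apply/cvgcP => e e0; have /cvgrPdist_lt/(_ e e0) := cf y.
  by apply: filterS => z; rewrite -rmorphB normc_real.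
- by congr (_%:C)%C; apply: f1; exists x.
- by move=> y Ky; congr (_%:C)%C; apply: f0; exists y.
Qed.

Lemma comm1P l : comm1 s si l <-> is_l1 l /\ forall n x, l n x <> 0 -> fixo n x.
Proof.
split=> [[hl hc]|[hl hf]]; split=> //.
  have hfix n x : l n x <> 0 -> sg n x = x.
    move=> lx; apply: contrapT => nx.
    have [||f [cf f1 f0]] := @urysohn_c [set sg (- n) x] x.
    - by apply: accessible_closed_set1; exact: hausdorff_accessible.
    - by move=> /= e; apply: nx; rewrite {1}e sigpK.
    have := congr1 (fun h : Sq => h n x) (hc f cf).
    by rewrite lmul_cst0l lmul_cst0r f1 mul1r f0// mulr0.
  (* Nonvanishing of [l n] is an open condition, which upgrades fixed points to interior ones. *)
  move=> n x lx; have lx0 : 0 < normc (l n x).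
    by rewrite lt_def normc_ge0 andbT; apply/eqP => /eq0_normc.
  have /cvgcP/(_ _ lx0) := hl.1 n x; apply: filterS => y hy.
  by apply: hfix => ly; move: hy; rewrite ly subr0 ltxx.
move=> f cf; apply/funext => n; apply/funext => x.
rewrite lmul_cst0l lmul_cst0r mulrC; have [->|/eqP lx] := eqVneq (l n x) 0.
  by rewrite !mul0r.
by rewrite (fixo_sigp (fixoN sK siK (hf _ _ lx))).
Qed.

End L1.

(** * The projection, and what each condition yields *)

Section Expectation.
Variables (R : realType) (X : topologicalType) (s si : X -> X).
Hypotheses (hX : hausdorff_space X) (cX : compact [set: X]) (X0 : [set: X] !=set0).
Hypotheses (sK : cancel s si) (siK : cancel si s) (cs : continuous s) (csi : continuous si).
Local Notation C := (R[i]).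
Local Notation Sq := (int -> X -> C).
Local Notation sg := (sigp s si).
Local Notation fixo k := (interior (Fixk s si k)).
Local Notation lmul := (lmul s si).
Local Notation lstar := (lstar s si).
Implicit Types (f g : X -> C) (l m : Sq) (U V : int -> R).

Lemma closed_fixo_of_unit k (e : X -> C) : continuous e ->
  (forall x, e x <> 0 -> fixo k x) ->
  (forall f, continuous f -> (forall x, f x <> 0 -> fixo k x) ->
     forall x, fixo k x -> e x * f x = f x) ->
  closed (fixo k).
Proof.
move=> ce e0 eu.
have e1 x : fixo k x -> e x = 1.
  move=> kx; have [||f [cf f1 f0]] := @urysohn_c R X hX cX (~` fixo k) x.
  - by apply: open_closedC; exact: open_interior.
  - by move=> /(_ kx).
  have := eu f cf _ x kx; rewrite f1 mulr1; apply=> y.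
  by apply: contra_notP => /f0.
(* [e] is 1 on the set and 0 off it, so points where [e] stays within distance less than 1 of 0
   avoid the set. *)
rewrite -[fixo k]setCK; apply: open_closedC; rewrite openE => x kx.
have ex0 : e x = 0 by apply: contrapT => /e0.
have /cvgcP/(_ 1 ltr01) := ce x; apply: filterS => y.
by rewrite ex0 sub0r normcN => hy /e1 ey; move: hy; rewrite ey normc1 ltxx.
Qed.

Lemma monom_comm00 k f : continuous f -> (forall x, f x <> 0 -> fixo k x) ->
  comm00 s si (monom k f).
Proof.
move=> cf fk; have h := monom_c00 k cf; split; [exact: h|apply/(comm1P hX cX sK siK)].
split=> [|n x]; [exact: (c00_l1 cX X0)|rewrite /monom; case: eqP => [->|//]; exact: fk].
Qed.

Lemma cond1_cond3 : cond1 R s si -> cond3 s si.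
Proof.
move=> [E [_ E1 Eid Em]] k; have c1 : is_c00 (monom k (fun _ : X => (1 : C))).
  by apply: monom_c00; exact: cst_continuous.
have /(comm1P hX cX sK siK)[El1 Ek] := E1 _ c1.
apply: (@closed_fixo_of_unit k (E (monom k (fun _ => 1)) k)).
- exact: El1.1.
- by move=> x; exact: Ek.
move=> f cf fk x kx; have := Em f _ cf c1.
have -> : lmul (cst0 f) (monom k (fun _ => 1)) = monom k f.
  apply/funext => n; apply/funext => y; rewrite lmul_cst0l /monom.
  by case: eqP => _; rewrite ?mulr1 ?mulr0.
rewrite Eid; last exact: monom_comm00.
move=> /(congr1 (fun h : Sq => h k x)); rewrite lmul_cst0l /monom eqxx mulrC.
by move=> <-.
Qed.

Lemma cond2_cond3 : cond2 R s si -> cond3 s si.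
Proof.
move=> [E [_ E1 Eid Em]] k; have c1 : is_c00 (monom k (fun _ : X => (1 : C))).
  by apply: monom_c00; exact: cst_continuous.
have /(comm1P hX cX sK siK)[El1 Ek] := E1 _ c1.
apply: (@closed_fixo_of_unit k (E (monom k (fun _ => 1)) k)).
- exact: El1.1.
- by move=> x; exact: Ek.
move=> f cf fk x kx; have := Em f _ cf c1.
(* The right action twists [f] by sigma^{-k}. The twist is invisible here: on Fix_k^o it fixes
   points, and off Fix_k^o both values vanish because that set is invariant along orbits. *)
have fs y : f (sg (- k) y) = f y.
  have [ky|ky] := pselect (fixo k y); first by rewrite (fixo_sigp (fixoN sK siK ky)).
  have -> : f y = 0 by apply: contrapT => /fk.
  by apply: contrapT => /fk /(fixo_orbitE sK siK cs csi).
have -> : lmul (monom k (fun _ => 1)) (cst0 f) = monom k f.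
  apply/funext => n; apply/funext => y; rewrite lmul_cst0r /monom.
  by case: eqP => [->|_]; rewrite ?mul1r ?mul0r ?fs.
rewrite Eid; last exact: monom_comm00.
move=> /(congr1 (fun h : Sq => h k x)); rewrite lmul_cst0r fs /monom eqxx.
by move=> <-.
Qed.

Lemma cst0_comm1 f : continuous f -> comm1 s si (cst0 f).
Proof.
move=> cf; apply/(comm1P hX cX sK siK); split.
  by apply: (c00_l1 cX X0); exact: (@monom_c00 R X 0 f).
by move=> n x; rewrite /cst0; case: eqP => [->|//] _; exact: fixo0.
Qed.

Lemma cond4_id (E : Sq -> Sq) : E @` (@is_l1 R X) = comm1 s si ->
  (forall l, is_l1 l -> E (E l) = E l) -> forall l, comm00 s si l -> E l = l.
Proof. by move=> Eim EE l [_]; rewrite -Eim => -[m /EE e <-]. Qed.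

Lemma cond4_cond1 : cond4 R s si -> cond1 R s si.
Proof.
move=> [E [El [Eim [EE [_ [_ [_ [Eb _]]]]]]]]; exists E; split.
- by move=> a b l m /(c00_l1 cX X0) hl /(c00_l1 cX X0) hm; exact: El.
- by move=> l /(c00_l1 cX X0) hl; rewrite -Eim; exists l.
- exact: cond4_id.
- by move=> f l cf /(c00_l1 cX X0) hl; apply: (Eb _ _ _ hl).1; exact: cst0_comm1.
Qed.

Lemma cond4_cond2 : cond4 R s si -> cond2 R s si.
Proof.
move=> [E [El [Eim [EE [_ [_ [_ [Eb _]]]]]]]]; exists E; split.
- by move=> a b l m /(c00_l1 cX X0) hl /(c00_l1 cX X0) hm; exact: El.
- by move=> l /(c00_l1 cX X0) hl; rewrite -Eim; exists l.
- exact: cond4_id.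
- by move=> f l cf /(c00_l1 cX X0) hl; apply: (Eb _ _ _ hl).2; exact: cst0_comm1.
Qed.

Definition fixind (k : int) (x : X) : C := if `[< fixo k x >] then 1 else 0.

(** Condition (3) enters only through the local constancy of [fixind]; linearity, the involution and
    the bimodule property are pointwise identities. *)
Definition Eop l : Sq := fun n x => fixind n x * l n x.

Lemma fixindT k x : fixo k x -> fixind k x = 1.
Proof. by move=> /asboolT h; rewrite /fixind h. Qed.

Lemma fixindF k x : ~ fixo k x -> fixind k x = 0.
Proof. by move=> /asboolF h; rewrite /fixind h. Qed.

Lemma fixind_eq j k x y : (fixo j x <-> fixo k y) -> fixind j x = fixind k y.
Proof. by move=> h; rewrite /fixind (asbool_equiv_eq h). Qed.

Lemma fixind_neq0 k x : fixind k x <> 0 -> fixo k x.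
Proof. by move=> h; apply: contrapT => /fixindF. Qed.

Lemma fixindN k x : fixind (- k) x = fixind k x.
Proof. exact/fixind_eq/fixoNE. Qed.

Lemma fixind_orbit k j x : fixind k (sg j x) = fixind k x.
Proof. exact/fixind_eq/fixo_orbitE. Qed.

Lemma fixindD j k x : fixo k x -> fixind (j + k) x = fixind j x.
Proof. by move=> h; apply/fixind_eq/fixoDE. Qed.

Lemma fixindB j k x : fixo k x -> fixind (j - k) x = fixind j x.
Proof. by move=> h; apply: fixindD; exact: fixoN. Qed.

Lemma fixind0 x : fixind 0 x = 1.
Proof. exact/fixindT/fixo0. Qed.

Lemma fixind_conj k x : conjc (fixind k x) = fixind k x.
Proof. by rewrite /fixind; case: ifP => _; rewrite ?conjc1 ?conjc0. Qed.

Lemma fixind_normc_le (k : int) x (z : C) : normc (fixind k x * z) <= normc z.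
Proof. by rewrite /fixind; case: ifP => _; rewrite ?mul1r// mul0r normc0 normc_ge0. Qed.

Lemma Eop_linear (D : set Sq) : linear_on D Eop.
Proof.
move=> a b l m _ _; apply/funext => n; apply/funext => x.
by rewrite /ladd /lscale /Eop; ring.
Qed.

Lemma Eop_id l : comm1 s si l -> Eop l = l.
Proof.
move=> /(comm1P hX cX sK siK)[_ h]; apply/funext => n; apply/funext => x.
rewrite /Eop; have [->|/eqP lx] := eqVneq (l n x) 0; first by rewrite mulr0.
by rewrite (fixindT (h _ _ lx)) mul1r.
Qed.

Lemma Eop_star l : Eop (lstar l) = lstar (Eop l).
Proof.
apply/funext => n; apply/funext => x.
by rewrite /Eop /Defs.lstar /alphak [in RHS]rmorphM /= fixind_conj fixind_orbit fixindN.
Qed.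

Lemma Eop_lmull a l : comm1 s si a -> Eop (lmul a l) = lmul a (Eop l).
Proof.
move=> /(comm1P hX cX sK siK)[_ ha]; apply/funext => n; apply/funext => x.
(* Where [a k x] is nonzero, [k] belongs to the subgroup at [x], so [n - k] belongs to it exactly
   when [n] does, and the indicator no longer depends on [k]. *)
have e k : a k x * alphak s si k (Eop l (n - k)) x =
    fixind n x * (a k x * alphak s si k (l (n - k)) x).
  rewrite /Eop /alphak fixind_orbit; have [->|/eqP ax] := eqVneq (a k x) 0.
    by rewrite !mul0r mulr0.
  by rewrite (fixindB _ (ha _ _ ax)) mulrCA.
rewrite /Defs.lmul (funext e) {1}/Eop.
(* The factor is 0 or 1, so it leaves [zsum] by cases, with no convergence to check. *)
have [nx|nx] := pselect (fixo n x).
  by rewrite fixindT// mul1r; congr zsum; apply/funext => k; rewrite mul1r.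
by rewrite fixindF// mul0r -[LHS]zsum0; congr zsum; apply/funext => k; rewrite mul0r.
Qed.

Lemma Eop_lmulr a l : comm1 s si a -> Eop (lmul l a) = lmul (Eop l) a.
Proof.
move=> /(comm1P hX cX sK siK)[_ ha]; apply/funext => n; apply/funext => x.
have e k : Eop l k x * alphak s si k (a (n - k)) x =
    fixind n x * (l k x * alphak s si k (a (n - k)) x).
  rewrite /Eop /alphak; have [->|/eqP ax] := eqVneq (a (n - k) (sg (- k) x)) 0.
    by rewrite !mulr0.
  have /(fixo_orbitE sK siK cs csi) kx := ha _ _ ax.
  by rewrite -(fixindD k kx) addrC subrK mulrA.
rewrite /Defs.lmul (funext e) {1}/Eop.
have [nx|nx] := pselect (fixo n x).
  by rewrite fixindT// mul1r; congr zsum; apply/funext => k; rewrite mul1r.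
by rewrite fixindF// mul0r -[LHS]zsum0; congr zsum; apply/funext => k; rewrite mul0r.
Qed.

Section Closed.
Hypothesis h3 : cond3 s si.

Lemma near_fixind k x : \forall y \near x, fixind k y = fixind k x.
Proof.
have [kx|kx] := pselect (fixo k x).
  have : nbhs x (fixo k) by apply: open_nbhs_nbhs; split=> //; exact: open_interior.
  by apply: filterS => y ky; rewrite !fixindT.
have : nbhs x (~` fixo k) by apply: open_nbhs_nbhs; split=> //; apply: closed_openC; exact: h3.
by apply: filterS => y ky; rewrite !fixindF.
Qed.

(** A neighbourhood that works for all integers at once need not exist; this is why positivity
    starts from finite support. *)
Lemma near_fixind_seq (r : seq int) x :
  \forall y \near x, {in r, forall k, fixind k y = fixind k x}.
Proof.
elim: r => [|k r IH]; first exact: nearW.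
near=> y => j; rewrite inE => /orP[/eqP ->|].
  by near: y; exact: near_fixind.
by move: j; near: y; exact: IH.
Unshelve. all: by end_near. Qed.

Lemma continuous_near_cst f : (forall x, \forall y \near x, f y = f x) -> continuous f.
Proof.
move=> h x; apply/cvgcP => e e0; have := h x; apply: filterS => y ->.
by rewrite subrr normc0.
Qed.

Lemma continuous_fixind k : continuous (fixind k).
Proof. by apply: continuous_near_cst => x; exact: near_fixind. Qed.

Lemma Eop_continuous l : (forall k, continuous (l k)) -> forall k, continuous (Eop l k).
Proof. by move=> cl k; apply: continuous_mulc; [exact: continuous_fixind|exact: cl]. Qed.

Lemma Eop_comm1 l : is_l1 l -> comm1 s si (Eop l).
Proof.
move=> hl; apply/(comm1P hX cX sK siK); split.
  have [U [A [U0 lU bU]]] := l1_major cX X0 hl.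
  apply: (major_l1 cX X0 _ _ bU); first by apply: Eop_continuous; exact: hl.1.
  by move=> k x; apply: le_trans (lU k x); exact: fixind_normc_le.
by move=> n x e; apply: fixind_neq0 => e0; apply: e; rewrite /Eop e0 mul0r.
Qed.

Lemma Eop_c00 l : is_c00 l -> comm00 s si (Eop l).
Proof.
move=> hl; split; last by apply: Eop_comm1; exact: (c00_l1 cX X0).
have [N hN] := c00_fin hl; apply: (@fin_c00 _ _ _ N).
  by apply: Eop_continuous; exact: hl.1.
by move=> k /hN e; apply/funext => x; rewrite /Eop e mulr0.
Qed.

Lemma l1norm_Eop l : is_l1 l -> (l1norm (Eop l) <= l1norm l)%E.
Proof.
move=> hl; apply: le_esum => k _; rewrite lee_fin; apply: supn_le => // x.
by apply: (le_trans (fixind_normc_le _ _ _)); apply: normc_le_supn => //; exact: hl.1.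
Qed.

Lemma lone_comm1 : comm1 s si (@lone R X).
Proof. by apply: cst0_comm1; exact: cst_continuous. Qed.

Lemma l1norm_lone : l1norm (@lone R X) = 1%E.
Proof.
have s1 k : supn (@lone R X k) = if k == 0 then 1 else 0.
  by rewrite /lone /cst0; case: eqP => _; rewrite supn_cst// ?normc1 ?normc0.
rewrite /l1norm; under eq_esum do rewrite s1.
transitivity (\esum_(k in [set (0 : int)]) (1%:E : \bar R))%E; last by rewrite esum_set1// lee_fin.
rewrite [RHS]esum_mkcond; apply: eq_esum => k _.
by rewrite in_set1; case: (k == 0).
Qed.

Lemma norm_one_Eop : norm_one Eop.
Proof.
apply/eqP; rewrite eq_le; apply/andP; split.
  by apply: ge_ereal_sup => _ [l [hl l1] <-]; apply: le_trans (l1norm_Eop hl) l1.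
apply: ereal_sup_ubound; exists (@lone R X).
  by split; [exact: (lone_comm1).1|rewrite l1norm_lone].
by rewrite Eop_id ?l1norm_lone//; exact: lone_comm1.
Qed.

(** The coefficient of l^* l at 0 is the sum over k of |l_k(sigma^k x)|^2. *)
Lemma lstar_lmul_ge0 l x : is_l1 l ->
  0 <= lmul (lstar l) l 0 x /\ (lmul (lstar l) l 0 x = 0 -> forall k, l k (sg k x) = 0).
Proof.
move=> hl; have [U [A [U0 lU bU]]] := l1_major cX X0 hl.
have [] := @zsum_ge0 R (fun k => lstar l k x * alphak s si k (l (0 - k)) x)
  (fun k => U (- k) * U (0 - k)) (A * A).
- by move=> k; rewrite normcM normc_conjc /alphak ler_pM ?normc_ge0.
- by apply: (@bsum_conv_term _ (fun k => U (- k))) => //; exact: bsum_opp.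
- by move=> k; rewrite /Defs.lstar /alphak sub0r mulrC mulcJ_ge0.
move=> h0 h1; split=> // e k; have := h1 e (- k).
rewrite /Defs.lstar /alphak sub0r opprK => /eqP; rewrite mulf_eq0 conjc_eq0 orbb.
by move/eqP.
Qed.

Lemma ladd_bigE n (F : 'I_n -> Sq) k x :
  (\big[@ladd R X/@lzero R X]_(j < n) F j) k x = \sum_(j < n) F j k x.
Proof.
elim: n F => [|n IH] F; first by rewrite !big_ord0.
by rewrite !big_ord_recl /ladd IH.
Qed.

(** [Eop] keeps the coefficient at 0, since [fixind 0] is 1; there a sum of squares vanishes, and
    its value at sigma^{-k} x isolates l_k(x). *)
Lemma Eop_faithful l : l1pos s si l -> Eop l = @lzero R X -> l = @lzero R X.
Proof.
move=> [n [ls [hl ->]]] e; have ls0 j : ls j = @lzero R X.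
  have z x : lmul (lstar (ls j)) (ls j) 0 x = 0.
    have := congr1 (fun h : Sq => h 0 x) e; rewrite /Eop fixind0 mul1r ladd_bigE.
    move=> /eqP; rewrite psumr_eq0 => [/allP/(_ j)|i _]; last exact: (lstar_lmul_ge0 x (hl i)).1.
    by rewrite mem_index_enum => /(_ isT) /eqP.
  apply/funext => k; apply/funext => x.
  by have := (lstar_lmul_ge0 _ (hl j)).2 (z (sg (- k) x)) k; rewrite sigpK.
apply/funext => k; apply/funext => x; rewrite ladd_bigE big1// => j _.
rewrite ls0 -[RHS]zsum0; congr zsum; apply/funext => i.
by rewrite /alphak /lzero mulr0.
Qed.

End Closed.
End Expectation.

(* The square root of 1 - h for a self-adjoint h of norm at most 1 in the
   commutant, where products are convolutions pointwise in x: 1 - b with b the limit of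
   the iteration b := (h + b^2) / 2, dominated by the same iteration on the
   majorant of h. *)
Section SquareRoot.
Variables (R : realType) (X : topologicalType) (s si : X -> X).
Hypotheses (hX : hausdorff_space X) (cX : compact [set: X]) (X0 : [set: X] !=set0).
Hypotheses (sK : cancel s si) (siK : cancel si s) (cs : continuous s) (csi : continuous si).
Local Notation C := (R[i]).
Local Notation Sq := (int -> X -> C).
Local Notation sg := (sigp s si).
Local Notation fixo k := (interior (Fixk s si k)).
Local Notation lmul := (lmul s si).
Local Notation lstar := (lstar s si).
Implicit Types (f g : X -> C) (l m : Sq) (U V : int -> R).

Definition sqz (u : int -> C) (n : int) : C := zsum (fun k => u k * u (n - k)).

(** From v v' - u u' = (v - u) v' + u (v' - u') and the same splitting of the majorants: squaring
    preserves the domination of increments. *)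
Lemma normc_sqz_diff (u v : int -> C) U V n :
  (forall k, 0 <= U k) -> (forall k, 0 <= V k) -> bsum V 1 -> (forall k, normc (u k) <= U k) ->
  (forall k, normc (v k - u k) <= V k - U k) ->
  normc (sqz v n - sqz u n) <= conv V V n - conv U U n.
Proof.
move=> U0 V0 bV uU vuVU.
have UV k : U k <= V k by rewrite -subr_ge0; apply: le_trans (vuVU k); exact: normc_ge0.
have vV k : normc (v k) <= V k.
  rewrite -(subrK (u k) (v k)); apply: (le_trans (le_normcD _ _)).
  by have := vuVU k; have := uU k; lra.
have bU : bsum U 1 by exact: bsum_le UV bV.
have UUVV k : U k * U (n - k) <= V k * V (n - k) by exact: ler_pM.
have bVV := bsum_conv_term V0 V0 bV bV n.
have tu k : normc (u k * u (n - k)) <= U k * U (n - k) by rewrite normcM ler_pM ?normc_ge0.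
have tv k : normc (v k * v (n - k)) <= V k * V (n - k) by rewrite normcM ler_pM ?normc_ge0.
rewrite /sqz -zsumB; last exact: zsum_cvg tu (bsum_le UUVV bVV).
  rewrite /conv -(zrB _ UUVV bVV); last by move=> k; exact: mulr_ge0.
  apply: (@normc_zsum _ _ _ (1 * 1)) => [k|]; last first.
    by apply: bsum_le bVV => k; rewrite gerBl mulr_ge0.
  have -> : v k * v (n - k) - u k * u (n - k) =
      (v k - u k) * v (n - k) + u k * (v (n - k) - u (n - k)) by ring.
  apply: (le_trans (le_normcD _ _)); rewrite !normcM.
  have -> : V k * V (n - k) - U k * U (n - k) =
      (V k - U k) * V (n - k) + U k * (V (n - k) - U (n - k)) by ring.
  by rewrite lerD// ler_pM ?normc_ge0.
exact: zsum_cvg tv bVV.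
Qed.

Lemma sqz0 n : sqz (fun _ => 0) n = 0.
Proof. by rewrite /sqz; under eq_fun do rewrite mul0r; exact: zsum0. Qed.

Variables (h : Sq) (H : int -> R).
Hypotheses (ch : comm1 s si h) (hherm : forall n x, conjc (h (- n) x) = h n x).
Hypotheses (hH : forall n x, normc (h n x) <= H n) (bH : bsum H 1).

Fixpoint bseq (j : nat) : Sq :=
  if j is j'.+1 then fun n x => (h n x + sqz (fun k => bseq j' k x) n) / 2
  else @lzero R X.

Fixpoint Bseq (j : nat) : int -> R :=
  if j is j'.+1 then fun n => (H n + conv (Bseq j') (Bseq j') n) / 2
  else fun=> 0.

Let H0 n : 0 <= H n.
Proof. by case: X0 => x _; apply: le_trans (hH n x); exact: normc_ge0. Qed.

(** Mass at most 1 is preserved because (1 + 1 * 1) / 2 = 1; this is where the norm bound on [h] is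
    spent. *)
Lemma Bseq_bound j : (forall n, 0 <= Bseq j n) /\ bsum (Bseq j) 1.
Proof.
elim: j => [|j [IH0 IH1]]; first by split=> [//|N]; rewrite /psum big1.
split=> [n|N] /=.
  by rewrite divr_ge0// addr_ge0// (conv_ge0 IH0 IH0 IH1 IH1).
have -> : psum (fun n => (H n + conv (Bseq j) (Bseq j) n) / 2) N =
    2^-1 * (psum H N + psum (conv (Bseq j) (Bseq j)) N).
  by rewrite -psumD -psumZ; congr psum; apply/funext => n; rewrite mulrC.
have := bH N; have := bsum_conv IH0 IH0 IH1 IH1 N; rewrite mulr1; lra.
Qed.

(** The two bounds go together because comparing increments of squares requires the size bound as
    well. *)
Lemma bseq_step j : (forall n x, normc (bseq j n x) <= Bseq j n) /\
  (forall n x, normc (bseq j.+1 n x - bseq j n x) <= Bseq j.+1 n - Bseq j n).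
Proof.
have n2 : normc (2^-1 : C) = 2^-1.
  by rewrite (_ : 2^-1 = (2^-1 : R)%:C%C) ?normc_real ?ger0_norm// fmorphV rmorphMn rmorph1.
elim: j => [|j [IH1 IH2]].
  split=> [n x|n x]; first by rewrite normc0.
  rewrite /= !subr0 sqz0 addr0 normcM n2 ler_wpM2r// (le_trans (hH n x))//.
  rewrite lerDl; exact: (conv_ge0 (Bseq_bound 0).1 (Bseq_bound 0).1 (Bseq_bound 0).2 (Bseq_bound 0).2).
have IH3 n x : normc (bseq j.+1 n x) <= Bseq j.+1 n.
  rewrite -(subrK (bseq j n x) (bseq j.+1 n x)); apply: (le_trans (le_normcD _ _)).
  by have := IH1 n x; have := IH2 n x; lra.
split=> // n x; have [B0 _] := Bseq_bound j; have [B1 b1] := Bseq_bound j.+1.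
have := normc_sqz_diff n B0 B1 b1 (IH1 ^~ x) (IH2 ^~ x).
set a := sqz _ n; set b := sqz _ n; set c := conv _ _ n; set d := conv _ _ n => hab.
have -> : bseq j.+2 n x - bseq j.+1 n x = (a - b) / 2 by rewrite /= -/a -/b; field.
have -> : Bseq j.+2 n - Bseq j.+1 n = (c - d) / 2 by rewrite /= -/c -/d; field.
by rewrite normcM n2 ler_wpM2r.
Qed.

Lemma bseq_diff n x i j : (i <= j)%N -> normc (bseq j n x - bseq i n x) <= Bseq j n - Bseq i n.
Proof.
move=> /subnK <-; elim: (j - i)%N => [|d IH]; first by rewrite !subrr normc0.
rewrite addSn -(subrKA (bseq (d + i) n x)) -(subrKA (Bseq (d + i) n)).
apply: (le_trans (le_normcD _ _)); rewrite lerD//.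
exact: (bseq_step (d + i)).2.
Qed.

Definition blim : Sq := fun n x => limn (fun j => bseq j n x).
Definition Blim n : R := limn (fun j => Bseq j n).

Lemma blimP n x : [/\ (fun j => bseq j n x) @ \oo --> blim n x,
  (fun j => Bseq j n) @ \oo --> Blim n &
  forall j, normc (blim n x - bseq j n x) <= Blim n - Bseq j n].
Proof.
have [] := @dominated_cvgn R (fun j => bseq j n x) (fun j => Bseq j n) 1.
- by move=> i j; exact: bseq_diff.
- by move=> j; have [B0 b] := Bseq_bound j; exact: bsum_term.
by move=> h1 h2 h3; split; [exact: h1|exact: h2|exact: h3].
Qed.

Lemma Bseq_le j n : Bseq j n <= Blim n.
Proof.
case: X0 => x _; have [_ _ /(_ j) e] := blimP n x.
by rewrite -subr_ge0; apply: le_trans e; exact: normc_ge0.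
Qed.

Lemma Blim_ge0 n : 0 <= Blim n. Proof. exact: (Bseq_le 0). Qed.

Lemma Bseq_cvg n : (fun j => Bseq j n) @ \oo --> Blim n.
Proof. by case: X0 => x _; have [] := blimP n x. Qed.

Lemma bsum_Blim : bsum Blim 1.
Proof.
move=> N; have c : (fun j => psum (fun k => Bseq j k) N) @ \oo --> psum Blim N.
  by apply: cvgn_psum => k; exact: Bseq_cvg.
rewrite -(cvg_lim _ c)//; apply: limr_le; first exact: cvgP c.
by apply: nearW => j; exact: (Bseq_bound j).2.
Qed.

(** The recursion reads [conv (Bseq j) (Bseq j) n = 2 * Bseq j.+1 n - H n], and partial sums pass to
    the limit. One inequality is enough for [sqz_blim], so limit and sum need not be exchanged. *)
Lemma conv_Blim_le n : conv Blim Blim n <= 2 * Blim n - H n.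
Proof.
apply: zr_le => [k|N]; first by rewrite mulr_ge0// Blim_ge0.
have c : (fun j => psum (fun k => Bseq j k * Bseq j (n - k)) N) @ \oo -->
    psum (fun k => Blim k * Blim (n - k)) N.
  by apply: cvgn_psum => k; apply: cvgM; exact: Bseq_cvg.
rewrite -(cvg_lim _ c)//; apply: limr_le; first exact: cvgP c.
apply: nearW => j; have [B0 b] := Bseq_bound j.
apply: (@le_trans _ _ (conv (Bseq j) (Bseq j) n)).
  exact: (psum_le_zr N (conv_term_ge0 B0 B0 n) (bsum_conv_term B0 B0 b b n)).
by have := Bseq_le j.+1 n; rewrite /=; lra.
Qed.

Lemma blim_le n x : normc (blim n x) <= Blim n.
Proof. by have [_ _ /(_ 0%N)] := blimP n x; rewrite /= !subr0. Qed.

Lemma sqz_blim n x : sqz (fun k => blim k x) n = 2 * blim n x - h n x.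
Proof.
apply/eqP; rewrite -subr_eq0; apply/eqP/eq0_normc/eqP.
rewrite eq_le normc_ge0 andbT.
(* 4 = 2 + 2: the squares differ by at most [2 * (Blim n - Bseq j.+1 n)] thanks to [conv_Blim_le],
   and replacing [2 * bseq j.+1] by [2 * blim] costs as much again. *)
have le4 j : normc (sqz (fun k => blim k x) n - (2 * blim n x - h n x)) <=
    4 * (Blim n - Bseq j.+1 n).
  have [B0 b] := Bseq_bound j.
  have e k : normc (blim k x - bseq j k x) <= Blim k - Bseq j k by have [_ _] := blimP k x.
  have := normc_sqz_diff n B0 Blim_ge0 bsum_Blim ((bseq_step j).1 ^~ x) e.
  set u := sqz (fun k => bseq j k x) n => hu.
  have -> : sqz (fun k => blim k x) n - (2 * blim n x - h n x) =
    (sqz (fun k => blim k x) n - u) + - (2 * (blim n x - bseq j.+1 n x)).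
    by rewrite /= -/u; field.
  apply: (le_trans (le_normcD _ _)); rewrite normcN normcM.
  have -> : normc (2 : C) = 2.
    by rewrite (_ : 2 = (2 : R)%:C%C) ?normc_real ?ger0_norm// rmorphMn rmorph1.
  have [_ _ /(_ j.+1) hb] := blimP n x.
  have := conv_Blim_le n; move: hu hb; rewrite /=; lra.
have c : (fun j => 4 * (Blim n - Bseq j.+1 n)) @ \oo --> 0.
  rewrite -(mulr0 4) -(subrr (Blim n)); apply: cvgM; first exact: cvg_cst.
  apply: cvgB; first exact: cvg_cst.
  by rewrite (cvg_shiftS (fun j => Bseq j n)); exact: Bseq_cvg.
by rewrite -(cvg_lim _ c)//; apply: limr_ge; [exact: cvgP c|exact: nearW].
Qed.

Lemma bseq_supp j n x : bseq j n x <> 0 -> fixo n x.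
Proof.
have [_ hs] := (comm1P hX cX sK siK h).1 ch.
elim: j n => [//|j IH] n; apply: contra_notP => nx /=.
have -> : h n x = 0 by apply: contrapT => /hs.
rewrite (_ : sqz _ n = 0) ?addr0 ?mul0r// -[RHS]zsum0; congr zsum; apply/funext => k.
have [->|/eqP /IH kx] := eqVneq (bseq j k x) 0; first by rewrite mul0r.
have [->|/eqP /IH nkx] := eqVneq (bseq j (n - k) x) 0; first by rewrite mulr0.
by case: nx; rewrite -(subrK k n); exact: fixoD.
Qed.

Lemma bseq_continuous j n : continuous (bseq j n).
Proof.
elim: j n => [|j IH] n; first exact: cst_continuous.
rewrite /=; apply: continuous_mulc; last exact: cst_continuous.
apply: continuous_addc; first by case: ch => -[].
have [B0 b] := Bseq_bound j.
apply: (@continuous_zsum R X X0 (fun k x => bseq j k x * bseq j (n - k) x) _ _ _ _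
  (bsum_conv_term B0 B0 b b n)).
  by move=> k; apply: continuous_mulc; exact: IH.
by move=> k x; rewrite normcM ler_pM ?normc_ge0 ?(bseq_step j).1.
Qed.

Lemma bseq_herm j n x : conjc (bseq j (- n) x) = bseq j n x.
Proof.
elim: j n => [|j IH] n; first exact: conjc0.
have [B0 b] := Bseq_bound j.
have c2 (y z : C) : conjc ((y + z) / 2) = (conjc y + conjc z) / 2.
  transitivity (conjc (y + z) * conjc (2^-1)); first exact: rmorphM.
  by rewrite conjc_inv conjc_nat; congr (_ / _); exact: rmorphD.
have bS (i : int) : bseq j.+1 i x = (h i x + sqz (fun k => bseq j k x) i) / 2 by [].
rewrite !bS c2 hherm; congr ((_ + _) / _).
rewrite /sqz (@conjc_zsum _ _ (fun k => Bseq j k * Bseq j (- n - k)) (1 * 1)).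
- rewrite -[RHS]zsum_opp; congr zsum; apply/funext => k.
  transitivity (conjc (bseq j k x) * conjc (bseq j (- n - k) x)); first exact: rmorphM.
  by rewrite -(IH (- k)) opprK -(IH (n + k)) opprD.
- by move=> k; rewrite normcM ler_pM ?normc_ge0 ?(bseq_step j).1.
- exact: bsum_conv_term.
Qed.

Lemma blim_comm1 : comm1 s si blim.
Proof.
apply/(comm1P hX cX sK siK); split.
  apply: (major_l1 cX X0 _ blim_le bsum_Blim) => n.
  apply: (@continuous_uniform_limit R X _ (fun j => bseq j n) (fun j => Blim n - Bseq j n)).
  - by move=> j; exact: bseq_continuous.
  - by move=> j x; have [_ _ e] := blimP n x; exact: e.
  - by rewrite -(subrr (Blim n)); apply: cvgB; [exact: cvg_cst|exact: Bseq_cvg].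
move=> n x; apply: contra_notP => nx; rewrite /blim; apply: lim_cplx.
have -> : (fun j => bseq j n x) = (fun=> 0); last exact: cvg_cst.
by apply/funext => j; apply: contrapT => /bseq_supp.
Qed.

Lemma blim_herm n x : conjc (blim (- n) x) = blim n x.
Proof.
apply/esym/lim_cplx/cvgcP => e e0.
have [/cvgcP/(_ e e0) c _ _] := blimP (- n) x; apply: filterS c => j.
by rewrite -(bseq_herm j n x) -rmorphB normc_conjc.
Qed.

End SquareRoot.

(** * Continuity of states on the commutant *)

Section States.
Variables (R : realType) (X : topologicalType) (s si : X -> X).
Hypotheses (hX : hausdorff_space X) (cX : compact [set: X]) (X0 : [set: X] !=set0).
Hypotheses (sK : cancel s si) (siK : cancel si s) (cs : continuous s) (csi : continuous si).
Local Notation C := (R[i]).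
Local Notation Sq := (int -> X -> C).
Local Notation sg := (sigp s si).
Local Notation fixo k := (interior (Fixk s si k)).
Local Notation lmul := (lmul s si).
Local Notation lstar := (lstar s si).
Local Notation comm1 := (@comm1 R X s si).
Implicit Types (f g : X -> C) (l m a b : Sq) (U V : int -> R).

(** Where [a k] does not vanish, sigma^k fixes the point, so the twist by alpha^k disappears. *)
Lemma comm1_lmulE a b n x : comm1 a -> lmul a b n x = zsum (fun k => a k x * b (n - k) x).
Proof.
move=> /(comm1P hX cX sK siK)[_ h]; congr zsum; apply/funext => k; rewrite /alphak.
have [->|/eqP/h kx] := eqVneq (a k x) 0; first by rewrite !mul0r.
by rewrite (fixo_sigp (fixoN sK siK kx)).
Qed.

Lemma comm1_lstarE a n x : comm1 a -> lstar a n x = conjc (a (- n) x).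
Proof.
move=> /(comm1P hX cX sK siK)[_ h]; rewrite /Defs.lstar /alphak; congr conjc.
have [nx|nx] := pselect (fixo (- n) x); first by rewrite (fixo_sigp nx).
have -> : a (- n) x = 0 by apply: contrapT => /h.
by apply: contrapT => /h/(fixo_orbitE sK siK cs csi).
Qed.

Lemma comm1_lin (p q : C) a b : comm1 a -> comm1 b -> comm1 (ladd (lscale p a) (lscale q b)).
Proof.
move=> /(comm1P hX cX sK siK)[la ha] /(comm1P hX cX sK siK)[lb hb].
apply/(comm1P hX cX sK siK); split.
  by apply: (ladd_l1 cX X0); exact: (lscale_l1 cX X0).
move=> n x; apply: contra_notP => nx; rewrite /ladd /lscale.
have -> : a n x = 0 by apply: contrapT => /ha.
have -> : b n x = 0 by apply: contrapT => /hb.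
by rewrite !mulr0 addr0.
Qed.

Lemma comm1_lmul a b : comm1 a -> comm1 b -> comm1 (lmul a b).
Proof.
move=> ca cb; have /(comm1P hX cX sK siK)[la ha] := ca.
have /(comm1P hX cX sK siK)[lb hb] := cb.
apply/(comm1P hX cX sK siK); split; first exact: lmul_l1.
move=> n x; apply: contra_notP => nx.
rewrite comm1_lmulE// -[RHS]zsum0; congr zsum; apply/funext => k.
have [->|/eqP/ha kx] := eqVneq (a k x) 0; first by rewrite mul0r.
have [->|/eqP/hb nkx] := eqVneq (b (n - k) x) 0; first by rewrite mulr0.
by case: nx; rewrite -(subrK k n); exact: fixoD.
Qed.

Lemma comm1_lstar a : comm1 a -> comm1 (lstar a).
Proof.
move=> ca; have /(comm1P hX cX sK siK)[la ha] := ca.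
apply/(comm1P hX cX sK siK); split; first exact: lstar_l1.
move=> n x; rewrite comm1_lstarE// => e; apply/(fixoNE sK siK)/ha => e0.
by apply: e; rewrite e0 conjc0.
Qed.

Lemma lzero_comm1 : comm1 (@lzero R X).
Proof.
apply/(comm1P hX cX sK siK); split=> //.
by apply: (@fin_l1 _ _ cX X0 _ 0) => // k; exact: cst_continuous.
Qed.

Variables (phi : Sq -> C) (hphi : is_state s si phi).

Lemma state_lin (p q : C) a b : comm1 a -> comm1 b ->
  phi (ladd (lscale p a) (lscale q b)) = p * phi a + q * phi b.
Proof. by case: hphi => h _ _; exact: h. Qed.

(** A + h = A (1 - h') for h' = - h / A, which has mass at most 1; hence it is A c^* c with c = 1 -
    b self-adjoint. *)
Lemma state_lower h (H : int -> R) A : comm1 h -> (forall n x, conjc (h (- n) x) = h n x) ->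
  (forall n x, normc (h n x) <= H n) -> bsum H A -> 0 < A -> 0 <= A%:C%C + phi h.
Proof.
move=> ch hh hH bH A0.
have Ai0 : 0 <= A^-1 by rewrite invr_ge0 ltW.
pose v : C := (- A^-1)%:C%C.
(* The zero summand only puts [h'] in the two-term form of [comm1_lin]. *)
pose h' := ladd (lscale v h) (lscale 0 h).
have h'E n x : h' n x = v * h n x by rewrite /h' /ladd /lscale mul0r addr0.
have ch' : comm1 h' by exact: comm1_lin.
have hh' n x : conjc (h' (- n) x) = h' n x.
  rewrite !h'E; transitivity (conjc v * conjc (h (- n) x)); first exact: rmorphM.
  by rewrite hh conjc_real.
have hH' n x : normc (h' n x) <= A^-1 * H n.
  by rewrite h'E normcM normc_real normrN ger0_norm// ler_wpM2l.
have bH' : bsum (fun n => A^-1 * H n) 1.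
  by move=> N; rewrite psumZ mulrC ler_pdivrMr// mul1r.
pose b := blim h'.
have cb : comm1 b by exact: (blim_comm1 hX cX X0 sK siK ch' hH' bH').
have b2 := sqz_blim X0 hH' bH'.
have bh := blim_herm X0 hh' hH' bH'.
pose c := ladd (lscale 1 (@lone R X)) (lscale (-1) b).
have l1 := @lone_comm1 R X s si hX cX X0 sK siK.
have cc : comm1 c by exact: comm1_lin.
have cE n x : c n x = (n == 0)%:R - b n x.
  by rewrite /c /ladd /lscale mul1r mulN1r /lone /cst0; case: (n == 0).
have csE n x : lstar c n x = c n x.
  rewrite comm1_lstarE// !cE oppr_eq0.
  transitivity (conjc (n == 0)%:R - conjc (b (- n) x)); first exact: rmorphB.
  by rewrite conjc_nat bh.
have [_ /(_ _ cc) hpos phi1] := hphi.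
have e : lmul (lstar c) c = ladd (lscale 1 (@lone R X)) (lscale (A^-1)%:C%C h).
  apply/funext => n; apply/funext => x; rewrite comm1_lmulE; last exact: comm1_lstar.
  pose d (k : int) : C := (k == 0)%:R.
  (* Sums containing the unit [d] collapse to one index, which leaves d n - b n - (b n - (2 b n - h'
     n)) = d n - h' n. *)
  have -> : (fun k => lstar c k x * c (n - k) x) =
      (fun k => d k * (d (n - k) - b (n - k) x) -
        (b k x * d (n - k) - b k x * b (n - k) x)).
    by apply/funext => k; rewrite csE !cE /d; ring.
  have d1 k : k != 0 -> d k * (d (n - k) - b (n - k) x) = 0.
    by move=> /negbTE k0; rewrite /d k0 mul0r.
  have d2 k : k != n -> b k x * d (n - k) = 0.
    by move=> /negbTE kn; rewrite /d subr_eq0 eq_sym kn mulr0.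
  have bL := blim_le X0 hH' bH'; have B0 := Blim_ge0 X0 hH' bH'.
  have bB := bsum_Blim X0 hH' bH'.
  have c3 : psum (fun k => b k x * b (n - k) x) @ \oo --> zsum (fun k => b k x * b (n - k) x).
    apply: (zsum_cvg _ (bsum_conv_term B0 B0 bB bB n)) => k.
    by rewrite normcM ler_pM ?normc_ge0// bL.
  have c2 := psum_cvg1 d2.
  have c23 : psum (fun k => b k x * d (n - k) - b k x * b (n - k) x) @ \oo -->
      zsum (fun k => b k x * d (n - k) - b k x * b (n - k) x).
    rewrite zsumB; [|exact: c2|exact: c3].
    have -> : psum (fun k => b k x * d (n - k) - b k x * b (n - k) x) =
        (fun N => psum (fun k => b k x * d (n - k)) N + (-1) * psum (fun k => b k x * b (n - k) x) N).
      by apply/funext => N; rewrite psumD psumN mulN1r.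
    rewrite -[- zsum _]mulN1r; apply: cvgcD; first exact: c2.
    by apply: cvgcM; [exact: cvg_cst|exact: c3].
  rewrite zsumB; [|exact: (psum_cvg1 d1)|exact: c23].
  rewrite zsumB; [|exact: c2|exact: c3].
  rewrite (zsum1 d1) (zsum1 d2) subrr subr0 [zsum _](b2 n x) h'E /d eqxx mul1r mulr1.
  rewrite /ladd /lscale /lone /cst0 /v rmorphN /=; case: (n == 0) => /=; rewrite -/b; ring.
move: hpos; rewrite e state_lin// phi1 mul1r => hpos.
have -> : A%:C%C + phi h = A%:C%C * (1 + (A^-1)%:C%C * phi h).
  by rewrite mulrDr mulr1 mulrA -rmorphM mulfV ?gt_eqF// mul1r.
by rewrite mulr_ge0// ler0c ltW.
Qed.

Lemma state_herm_bounded h (H : int -> R) A : comm1 h ->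
  (forall n x, conjc (h (- n) x) = h n x) ->
  (forall n x, normc (h n x) <= H n) -> bsum H A -> 0 < A -> normc (phi h) <= A.
Proof.
move=> ch hh hH bH A0; have := state_lower ch hh hH bH A0.
pose h' := ladd (lscale (-1) h) (lscale 0 h).
have h'E n x : h' n x = - h n x by rewrite /h' /ladd /lscale mul0r addr0 mulN1r.
have : 0 <= A%:C%C + phi h'.
  apply: (@state_lower _ H) => //.
  - exact: comm1_lin.
  - by move=> n x; rewrite !h'E -(hh n x); exact: rmorphN.
  - by move=> n x; rewrite h'E normcN.
rewrite /h' state_lin// mul0r addr0 mulN1r.
(* In the order of [R[i]], being nonnegative includes being real, so [phi h] is real and the two
   inequalities bound it from both sides. *)
case: (phi h) => p q; rewrite !lecE /= => /andP[_ h1] /andP[/eqP q0 h2].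
have -> : q = 0 by move: q0; rewrite add0r.
by rewrite expr0n /= addr0 sqrtr_sqr ler_norml; lra.
Qed.

(** Write d = r + i t with r and t self-adjoint. Symmetrising [H] majorises both without increasing
    the mass, whence the factor 2. *)
Lemma state_bounded d (H : int -> R) A : comm1 d ->
  (forall n x, normc (d n x) <= H n) -> bsum H A -> 0 < A -> normc (phi d) <= 2 * A.
Proof.
move=> cd hH bH A0; have csd := comm1_lstar cd.
have bHn : bsum (fun n => (H n + H (- n)) / 2) A.
  move=> N.
  have -> : psum (fun n => (H n + H (- n)) / 2) N = 2^-1 * (psum H N + psum H N).
    rewrite -[X in _ + X]psum_opp -psumD -psumZ.
    by congr psum; apply/funext => n; rewrite mulrC.
  by have := bH N; lra.
(* This is 1 / (2 i), the coefficient in the imaginary part of [d]. *)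
pose q : C := (0 +i* (- 2^-1))%C.
pose w : C := ((2^-1)%:C)%C.
have nw (p y z : C) n : normc p = 2^-1 -> normc y <= H n -> normc z <= H (- n) ->
    normc (p * y + p * z) <= (H n + H (- n)) / 2.
  move=> np hy hz; rewrite -mulrDr normcM np mulrC ler_wpM2r//.
  by apply: (le_trans (le_normcD _ _)); exact: lerD.
have dE n x : lstar d n x = conjc (d (- n) x) by exact: comm1_lstarE.
pose r := ladd (lscale w d) (lscale w (lstar d)).
pose t := ladd (lscale q d) (lscale (- q) (lstar d)).
have hr : normc (phi r) <= A.
  apply: state_herm_bounded bHn A0; first exact: comm1_lin.
    move=> n x; rewrite /r /ladd /lscale !dE opprK.
    transitivity (conjc w * conjc (d (- n) x) + conjc w * conjc (conjc (d n x))).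
      by rewrite -!rmorphM -rmorphD.
    by rewrite conjcK conjc_real addrC.
  move=> n x; rewrite /r /ladd /lscale dE; apply: nw => //.
    by rewrite normc_real ger0_norm.
  by rewrite normc_conjc.
have ht : normc (phi t) <= A.
  apply: state_herm_bounded bHn A0; first exact: comm1_lin.
    move=> n x; rewrite /t /ladd /lscale !dE opprK.
    transitivity (conjc q * conjc (d (- n) x) + conjc (- q) * conjc (conjc (d n x))).
      by rewrite -!rmorphM -rmorphD.
    have -> : conjc q = - q by rewrite /q /=; congr Complex; rewrite oppr0.
    have -> : conjc (- q) = q by rewrite /q /=; congr Complex; rewrite ?oppr0 ?opprK.
    by rewrite conjcK addrC.
  move=> n x; rewrite /t /ladd /lscale dE mulNr -mulrN; apply: nw => //.
    by rewrite /q /= expr0n /= add0r sqrrN sqrtr_sqr ger0_norm.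
  by rewrite normcN normc_conjc.
have e : d = ladd (lscale 1 r) (lscale (0 +i* 1)%C t).
  apply/funext => n; apply/funext => x; rewrite /ladd /lscale /r /t /ladd /lscale.
  have qi : (0 +i* 1)%C * q = w.
    by rewrite /q /w; apply/eqP; rewrite eq_complex /=; apply/andP; split; apply/eqP; lra.
  rewrite mul1r mulrDr !mulrA mulrN qi mulNr.
  have -> : w * d n x + w * lstar d n x + (w * d n x - w * lstar d n x) = (w + w) * d n x by ring.
  have -> : w + w = 1 by rewrite /w -rmorphD (_ : 2^-1 + 2^-1 = 1)//; lra.
  by rewrite mul1r.
rewrite e state_lin; [|exact: comm1_lin|exact: comm1_lin].
apply: (le_trans (le_normcD _ _)); rewrite !normcM.
rewrite (_ : normc (0 +i* 1)%C = 1); last by rewrite /= expr0n /= add0r expr1n sqrtr1.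
by rewrite normc1 !mul1r; lra.
Qed.

Lemma state_sum (I : Type) (r : seq I) (F : I -> Sq) : (forall j, comm1 (F j)) ->
  comm1 (\big[@ladd R X/@lzero R X]_(j <- r) F j) /\
  phi (\big[@ladd R X/@lzero R X]_(j <- r) F j) = \sum_(j <- r) phi (F j).
Proof.
move=> cF.
have sc l : l = lscale 1 l by apply/funext => n; apply/funext => x; rewrite /lscale mul1r.
elim: r => [|j r [IH1 IH2]].
  rewrite !big_nil; split; first exact: lzero_comm1.
  have e : @lzero R X = ladd (lscale 0 (@lzero R X)) (lscale 0 (@lzero R X)).
    by apply/funext => n; apply/funext => x; rewrite /ladd /lscale !mul0r addr0.
  by rewrite e state_lin ?mul0r ?addr0//; exact: lzero_comm1.
rewrite !big_cons (sc (F j)) (sc (\big[_/_]_(j <- r) F j)); split; first exact: comm1_lin.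
by rewrite state_lin// !mul1r IH2 -sc.
Qed.

End States.

(** * Positivity of the projection under states *)

Section Positivity.
Variables (R : realType) (X : topologicalType) (s si : X -> X).
Hypotheses (hX : hausdorff_space X) (cX : compact [set: X]) (X0 : [set: X] !=set0).
Hypotheses (sK : cancel s si) (siK : cancel si s) (cs : continuous s) (csi : continuous si).
Hypothesis h3 : cond3 s si.
Local Notation C := (R[i]).
Local Notation Sq := (int -> X -> C).
Local Notation sg := (sigp s si).
Local Notation fixo k := (interior (Fixk s si k)).
Local Notation lmul := (lmul s si).
Local Notation lstar := (lstar s si).
Local Notation comm1 := (@comm1 R X s si).
Local Notation fixi := (@fixind R X s si).
Local Notation Ex := (@Eop R X s si).
Implicit Types (f g : X -> C) (l m a b : Sq) (U V : int -> R).

Lemma Eop_lstar_lmul_comm1 l : is_l1 l -> comm1 (Ex (lmul (lstar l) l)).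
Proof.
move=> hl; apply: (Eop_comm1 hX cX X0 sK siK h3).
exact: (lmul_l1 cX X0 cs csi (lstar_l1 cX X0 cs csi hl) hl).
Qed.

(* For finitely supported l, E(l^* l) is a finite sum of squares of elements of
   the commutant: {k | x in Fix_k^o} is a subgroup G_x of Z, and the summand of
   index j collects the coefficients of l on the coset j + G_x. Each coset is met by
   [cosetn j x] indices j of the window, whence the normalisation. *)
Section FiniteSupport.
Variables (l : Sq) (N : nat).
Hypotheses (cl : forall k, continuous (l k)).
Hypotheses (lN : forall k, (N < `|k|)%N -> l k = (fun _ => 0)).

Definition cosetn (j : int) (x : X) : nat := count (fun i => fixi (i - j) x == 1) (win N).

(** The weight enters each square twice, hence the root. Outside the window the count may be 0, and
    the weight is then 0. *)
Definition cosetw (j : int) (x : X) : C := ((Num.sqrt (cosetn j x)%:R)^-1)%:C%C.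

(** This is [cosetw j] times E(delta^{-j} l): the shift moves the coset j + G_x onto G_x, where E
    retains it. *)
Definition cosetpart (j : int) : Sq :=
  fun k x => cosetw j x * (fixi k x * l (j + k) (sg j x)).

Lemma near_cosetn j x : \forall y \near x, cosetn j y = cosetn j x.
Proof.
have := @near_fixind_seq R X s si h3 [seq i - j | i <- win N] x; apply: filterS => y h.
by apply: eq_in_count => i iN; rewrite h//; exact: map_f.
Qed.

Lemma cosetw_sqr j x : conjc (cosetw j x) * cosetw j x = (cosetn j x)%:R^-1.
Proof.
rewrite /cosetw conjc_real -rmorphM -invfM -expr2 sqr_sqrtr ?ler0n//.
by rewrite (fmorphV (real_complex R)) rmorph_nat.
Qed.

Lemma cosetpart_comm1 j : comm1 (cosetpart j).
Proof.
apply/(comm1P hX cX sK siK); split; last first.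
  move=> k x; apply: contra_notP => kx.
  by rewrite /cosetpart fixindF// mul0r mulr0.
apply: (@fin_l1 _ _ cX X0 _ (N + `|j|)%N) => k.
  apply: continuous_mulc.
    apply: continuous_near_cst => x; have := near_cosetn j x.
    by apply: filterS => y e; rewrite /cosetw e.
  apply: continuous_mulc; first exact: continuous_fixind.
  by apply: continuous_comp_sigp; [exact: cs|exact: csi|exact: cl].
move=> hk; apply/funext => x; rewrite /cosetpart lN ?mulr0//; lia.
Qed.

Lemma cosetn_sum i x : (\sum_(j <- win N) fixi (i - j) x : C) = (cosetn i x)%:R.
Proof.
rewrite /cosetn -sum1_count natr_sum [RHS]big_mkcond /=; apply: eq_bigr => j _.
rewrite -(fixindN R sK siK (i - j)) opprB /fixind; case: ifP => _.
  by rewrite eqxx.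
by rewrite eq_sym oner_eq0.
Qed.

Lemma cosetn_eq i j x : fixo (i - j) x -> cosetn j x = cosetn i x.
Proof.
move=> ij; apply: eq_count => k; rewrite -(fixindD R sK siK (k - i) ij).
by congr (fixi _ x == 1); lia.
Qed.

Lemma cosetn_gt0 i x : i \in win N -> (0 < cosetn i x)%N.
Proof.
move=> iN; rewrite /cosetn -has_count; apply/hasP; exists i => //.
by rewrite subrr fixind0.
Qed.

Lemma Eop_lstar_lmul_cosets : Ex (lmul (lstar l) l) =
  \big[@ladd R X/@lzero R X]_(j <- win N) lmul (lstar (cosetpart j)) (cosetpart j).
Proof.
apply/funext => n; apply/funext => x.
have -> : (\big[@ladd R X/@lzero R X]_(j <- win N) lmul (lstar (cosetpart j)) (cosetpart j)) n x
   = \sum_(j <- win N) lmul (lstar (cosetpart j)) (cosetpart j) n x.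
  by elim: (win N) => [|j r IH]; rewrite ?big_nil// !big_cons /ladd IH.
(* The terms of (l^* l)(n) at [x], reindexed by i = - k. *)
pose F i := conjc (l i (sg i x)) * l (n + i) (sg i x).
have F0 i : i \notin win N -> F i = 0.
  by rewrite mem_win -ltnNge => /lN e; rewrite /F e conjc0 mul0r.
have -> : Ex (lmul (lstar l) l) n x = fixi n x * \sum_(i <- win N) F i.
  rewrite /Eop; congr (_ * _); rewrite -(zsum_seq (win_uniq N) F0) -zsum_opp.
  by congr zsum; apply/funext => k; rewrite /F /Defs.lstar /alphak opprK.
(* Put i = j + k. For k in G_x one has sigma^{j+k} x = sigma^j x, so the square of index [j] is the
   part of the sum of [F] over j + G_x, divided by the multiplicity. *)
have e j : lmul (lstar (cosetpart j)) (cosetpart j) n x =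
    fixi n x * \sum_(i <- win N) (cosetn j x)%:R^-1 * fixi (i - j) x * F i.
  have cj := cosetpart_comm1 j.
  have csj := comm1_lstar hX cX X0 sK siK cs csi cj.
  rewrite (comm1_lmulE hX cX sK siK _ _ _ csj).
  pose u k := fixi n x * ((cosetn j x)%:R^-1 * fixi k x * F (j + k)).
  transitivity (zsum u).
    rewrite -zsum_opp; congr zsum; apply/funext => k.
    rewrite (comm1_lstarE hX cX sK siK cs csi _ _ cj) !opprK /cosetpart /u.
    have [kx|kx] := pselect (fixo k x); last by rewrite (fixindF R kx) !(mul0r, mulr0) conjc0 mul0r.
    rewrite (fixindT R kx) (fixindD R sK siK n kx) mul1r mulr1 -cosetw_sqr /F.
    rewrite (sigpD sK siK j k) (fixo_sigp kx) (addrCA n j k).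
    set y := l _ _; set z := l _ _; set p := cosetw j x.
    have -> : conjc (p * y) = conjc p * conjc y by exact: rmorphM.
    by ring.
  rewrite (@zsum_seq _ _ [seq i - j | i <- win N]).
  - rewrite big_map mulr_sumr; apply: eq_bigr => i _.
    by rewrite /u (addrC j) subrK.
  - by rewrite map_inj_uniq ?win_uniq//; exact: addIr.
  - move=> k hk; rewrite /u F0 ?mulr0//; apply: contra hk => hk.
    by apply/mapP; exists (j + k) => //; rewrite addrC addrA addNr add0r.
under [RHS]eq_bigr do rewrite e.
rewrite -mulr_sumr exchange_big /=; congr (_ * _); apply: eq_big_seq => i iN.
rewrite -mulr_suml -[LHS]mul1r; congr (_ * _).
(* The contributing [j] lie in the coset of [i]; they share the count [cosetn i x], which is also
   their number, and it is nonzero because [i] is in the window. *)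
transitivity (\sum_(j <- win N) (cosetn i x)%:R^-1 * fixi (i - j) x : C).
  rewrite -mulr_sumr cosetn_sum mulVf// pnatr_eq0 -lt0n; exact: cosetn_gt0.
apply: eq_bigr => j _; have [kx|kx] := pselect (fixo (i - j) x).
  by rewrite (cosetn_eq kx).
by rewrite (fixindF R kx) !mulr0.
Qed.

End FiniteSupport.

Variables (phi : Sq -> C) (hphi : is_state s si phi).

Lemma state_Eop_fin l N : (forall k, continuous (l k)) ->
  (forall k, (N < `|k|)%N -> l k = (fun _ => 0)) -> 0 <= phi (Ex (lmul (lstar l) l)).
Proof.
move=> cl lN; rewrite (Eop_lstar_lmul_cosets cl lN).
have cj j : comm1 (cosetpart l N j) by exact: cosetpart_comm1.
have cs2 j : comm1 (lmul (lstar (cosetpart l N j)) (cosetpart l N j)).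
  exact: (comm1_lmul hX cX X0 sK siK cs csi (comm1_lstar hX cX X0 sK siK cs csi (cj j)) (cj j)).
have [_ ->] := state_sum hX cX X0 sK siK hphi (win N) cs2.
by apply: sumr_ge0 => j _; case: hphi => _ h _; exact: h.
Qed.

Definition trunc (N : nat) l : Sq := fun k => if (`|k| <= N)%N then l k else (fun _ => 0).

Lemma bsum_trunc U A N : (forall k, 0 <= U k) -> bsum U A ->
  bsum (fun k => if (`|k| <= N)%N then 0 else U k) (zr U - psum U N).
Proof.
move=> U0 b M; set T := fun k => _.
have T0 k : 0 <= T k by rewrite /T; case: ifP.
(* On the window [M + N], which contains the window [N], the tail sum is an exact difference of
   partial sums of [U]. *)
apply: (@le_trans _ _ (psum T (M + N))); first by apply: psum_nd => //; exact: leq_addr.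
suff -> : psum T (M + N) = psum U (M + N) - psum U N by rewrite lerD2r; exact: psum_le_zr b.
elim: M => [|M IH].
  rewrite add0n subrr psumE big1_seq// => k /andP[_]; rewrite mem_win => kN.
  by rewrite /T kN.
rewrite addSn !psumS IH addrAC; congr (_ + _ + _).
by rewrite /T !ifF//; lia.
Qed.

Lemma state_Eop_lstar_lmul l : is_l1 l -> 0 <= phi (Ex (lmul (lstar l) l)).
Proof.
move=> hl; have [U [A [U0 lU bU]]] := l1_major cX X0 hl.
set h := Ex _; set S := zr U.
have S0 : 0 <= S by exact: zr_ge0 bU.
have tcl N k : continuous (trunc N l k).
  by rewrite /trunc; case: ifP => _; [exact: hl.1|exact: cst_continuous].
have tl0 N k : (N < `|k|)%N -> trunc N l k = (fun _ => 0).
  by rewrite ltnNge /trunc => /negbTE ->.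
have tl N : is_l1 (trunc N l) by exact: (fin_l1 cX X0 (tcl N) (@tl0 N)).
have ch : comm1 h by exact: Eop_lstar_lmul_comm1.
(* Truncating l changes l^* l by at most two convolutions of [U] with its tail (up to reflection),
   of total mass at most [2 * S * (S - psum U N)]. The outer 2 is that of [state_bounded]; [e] keeps
   the bound positive when the tail is 0. *)
have near_phi N (e : R) : 0 < e ->
    exists2 z : C, 0 <= z & normc (phi h - z) <= 2 * (2 * S * (S - psum U N) + e).
  move=> e0; pose hN := Ex (lmul (lstar (trunc N l)) (trunc N l)).
  have chN : comm1 hN by exact: Eop_lstar_lmul_comm1.
  exists (phi hN); first exact: (state_Eop_fin (tcl N) (@tl0 N)).
  pose d := ladd (lscale 1 h) (lscale (-1) hN).
  have cd : comm1 d by exact: comm1_lin.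
  have -> : phi h - phi hN = phi d.
    by rewrite /d (state_lin hphi _ _ ch chN) mul1r mulN1r.
  pose T k := if (`|k| <= N)%N then 0 else U k.
  have T0 k : 0 <= T k by rewrite /T; case: ifP.
  have bT : bsum T (S - psum U N) := bsum_trunc N U0 bU.
  have bS : bsum U S := bsum_zr U0 bU.
  have Un0 k : 0 <= U (- k) by exact: U0.
  have Tn0 k : 0 <= T (- k) by exact: T0.
  pose H n := conv (fun k => T (- k)) U n + conv (fun k => U (- k)) T n.
  apply: (@state_bounded _ _ _ _ hX cX X0 sK siK cs csi _ hphi d H _ cd).
  - move=> n x.
    have -> : d n x = fixi n x * (lmul (lstar l) l n x - lmul (lstar (trunc N l)) (trunc N l) n x).
      by rewrite /d /ladd /lscale /h /hN /Eop; ring.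
    apply: (le_trans (fixind_normc_le _ _ _ _ _)).
    have tU k y : normc (trunc N l k y) <= U k.
      by rewrite /trunc; case: ifP => _; rewrite ?lU// normc0.
    have sU k y : normc (lstar l k y) <= U (- k) by rewrite normc_conjc /alphak.
    have stU k y : normc (lstar (trunc N l) k y) <= U (- k) by rewrite normc_conjc /alphak.
    have bSn := bsum_opp bS; have bTn := bsum_opp bT.
    have b1 := bsum_conv_term Tn0 U0 bTn bS n.
    have b2 := bsum_conv_term Un0 T0 bSn bT n.
    have cv1 := @lmul_cvg R X s si (lstar l) l _ _ _ _ Un0 U0 sU lU bSn bS n x.
    have cv2 := @lmul_cvg R X s si (lstar (trunc N l)) (trunc N l) _ _ _ _ Un0 U0 stU tU bSn bS n x.
    rewrite /Defs.lmul -zsumB; [|exact: cv1|exact: cv2].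
    have m0 k : 0 <= T (- k) * U (n - k) by exact: mulr_ge0.
    have m1 k : 0 <= U (- k) * T (n - k) by exact: mulr_ge0.
    rewrite /H /conv -(zrD m0 m1 b1 b2).
    apply: (@normc_zsum _ _ _ ((S - psum U N) * S + S * (S - psum U N))); last first.
      by move=> M; rewrite psumD lerD.
    move=> k; rewrite /Defs.lstar /alphak /trunc /T.
    have nn : normc (conjc (l (- k) (sg (- k) x)) * l (n - k) (sg (- k) x)) <= U (- k) * U (n - k).
      by rewrite normcM normc_conjc ler_pM ?normc_ge0.
    (* With both indices in the window the difference is 0; otherwise at least one majorant term is
       the full [U (- k) * U (n - k)]. *)
    case: ifP => _; case: ifP => _; rewrite ?conjc0 ?(mul0r, mulr0) ?subr0 ?subrr ?normc0 ?add0r ?addr0//.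
    by rewrite ler_wpDr// mulr_ge0.
  - move=> M; rewrite psumD.
    have := bsum_conv Tn0 U0 (bsum_opp bT) bS M.
    have := bsum_conv Un0 T0 (bsum_opp bS) bT M.
    have -> : 2 * S * (S - psum U N) = (S - psum U N) * S + S * (S - psum U N) by ring.
    by lra.
  - rewrite ltr_wpDl// !mulr_ge0// subr_ge0; exact: psum_le_zr bU.
have close (e : R) : 0 < e -> exists2 z : C, 0 <= z & normc (phi h - z) <= e.
  move=> e0.
  have c : (fun N => 2 * S * (S - psum U N)) @ \oo --> 0.
    rewrite -(mulr0 (2 * S)) -(subrr S); apply: cvgM; first exact: cvg_cst.
    by apply: cvgB; [exact: cvg_cst|exact: zr_cvg bU].
  (* Chosen so that [2 * (e / 4 + e / 4) = e]. *)
  have e4 : 0 < e / 4 by rewrite divr_gt0.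
  have /cvgrPdist_lt/(_ _ e4) := c; move=> /filter_ex[N]; rewrite sub0r normrN => hN.
  have [z z0 hz] := near_phi N _ e4; exists z => //; apply: (le_trans hz).
  by have := le_lt_trans (ler_norm _) hN; lra.
have re z : 0 <= z :> C -> 0 <= complex.Re z /\ complex.Im z = 0.
  by rewrite lecE /= => /andP[/eqP ->].
rewrite lecE /=; apply/andP; split.
  rewrite -normr_le0; apply/ler_addgt0Pr => e e0; rewrite add0r.
  have [z /re[_ zI] hz] := close e e0; apply: le_trans hz.
  apply: le_trans (normc_Im _); rewrite (_ : complex.Im (phi h - z) = complex.Im (phi h))//.
  by move: zI; case: (phi h) => p q; case: z => p' q' /= ->; rewrite subr0.
apply/ler_addgt0Pr => e e0.
have [z /re[zR _] hz] := close e e0; have := le_trans (normc_Re _) hz.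
rewrite (_ : complex.Re (phi h - z) = complex.Re (phi h) - complex.Re z); last first.
  by case: (phi h) => p q; case: z {zR hz}.
by rewrite ler_norml => /andP[]; lra.
Qed.

Lemma state_Eop_pos l : l1pos s si l -> 0 <= phi (Ex l).
Proof.
move=> [n [ls [hl ->]]].
have c2 j : comm1 (Ex (lmul (lstar (ls j)) (ls j))) by exact: Eop_lstar_lmul_comm1.
have -> : Ex (\big[@ladd R X/@lzero R X]_(j < n) lmul (lstar (ls j)) (ls j)) =
    \big[@ladd R X/@lzero R X]_(j < n) Ex (lmul (lstar (ls j)) (ls j)).
  apply/funext => k; apply/funext => x; rewrite {1}/Eop !ladd_bigE.
  by rewrite mulr_sumr.
have [_ ->] := state_sum hX cX X0 sK siK hphi (index_enum 'I_n) c2.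
by apply: sumr_ge0 => j _; exact: state_Eop_lstar_lmul.
Qed.

End Positivity.

(** * Assembly of the equivalence *)

Section Main.
Variables (R : realType) (X : topologicalType) (s si : X -> X).
Hypotheses (hX : hausdorff_space X) (cX : compact [set: X]) (X0 : [set: X] !=set0).
Hypotheses (sK : cancel s si) (siK : cancel si s) (cs : continuous s) (csi : continuous si).

Lemma cond3_cond4 : cond3 s si -> cond4 R s si.
Proof.
move=> h3; exists (@Eop R X s si); split; first exact: Eop_linear.
have E1 l : is_l1 l -> comm1 s si (@Eop R X s si l) by move=> hl; exact: Eop_comm1.
have Eid := Eop_id hX cX sK siK.
split.
  apply/seteqP; split=> [_ [l hl <-]|l hl]; first exact: E1.
  by exists l; [exact: hl.1|exact: Eid].
split; first by move=> l /E1; exact: Eid.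
split; first by move=> l; exact: Eop_faithful.
split; first by move=> l _; exact: Eop_star.
split; first exact: norm_one_Eop.
split.
  by move=> a l ca _; split; [exact: Eop_lmull|exact: Eop_lmulr].
split.
  apply/seteqP; split=> [_ [l hl <-]|l hl]; first exact: Eop_c00.
  by exists l; [exact: hl.1|apply: Eid; exact: hl.2].
by move=> phi hphi l; exact: state_Eop_pos.
Qed.

End Main.

Theorem theorem5p6 (R : realType) (X : topologicalType) (s si : X -> X) :
  hausdorff_space X -> compact [set: X] -> [set: X] !=set0 ->
  cancel s si -> cancel si s -> continuous s -> continuous si ->
  [<-> cond1 R s si; cond2 R s si; cond3 s si; cond4 R s si].
Proof.
move=> hX cX X0 sK siK cs csi.
have c34 : cond3 s si -> cond4 R s si by exact: cond3_cond4.
tfae.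
(* The module sides are not exchanged directly: (1) reaches (2) through (3) and the bimodule
   property in (4). *)
- by move=> h1; apply: cond4_cond2 => //; apply: c34; exact: cond1_cond3 h1.
- by move=> h2; exact: cond2_cond3 h2.
- exact: c34.
- by move=> h4; exact: cond4_cond1 h4.
Qed.
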